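(* Let $s$ be a positive integer, and let $X$ denote the size of a partition chosen uniformly at random from the set of $(s,s+1)$-core partitions. Then the eighth moment of $X$ about its mean is $$\mathbf{E}\big[(X-\mathbf{E}[X])^8\big]=\frac{1}{914624815104000}\, s^2(s-1)(2s+1)(s+1)^2\,P(s),$$ where $$\begin{aligned}P(s)={}&308851624s^{18}-2759073420s^{17}+7345195650s^{16}+1614779679s^{15}-27716691813s^{14}\\&-3203324556s^{13}+61922226136s^{12}+52270343442s^{11}-49025878614s^{10}-146716496688s^9\\&-153171599682s^8-30342055161s^7+158893451131s^6-165853921776s^5+1073038790016s^4\\&+9260929255680s^3-11293714925568s^2-19188060088320s+21924617379840.\end{aligned}$$
   Context: A partition is a non-increasing finite sequence of positive integers $\lambda=(\lambda_1,\dots,\lambda_k)$, $k\ge 0$ (the empty partition is allowed); its size is $\lambda_1+\dots+\lambda_k$. Its Ferrers diagram consists of the cells $(i,j)$ with $1\le i\le k$, $1\le j\le\lambda_i$. The hook length of cell $(i,j)$ is $\lambda_i-j+\lambda'_j-i+1$, where $\lambda'$ is the conjugate partition ($\lambda'_j$ = number of $i$ with $\lambda_i\ge j$). A partition is an $s$-core if no cell has hook length equal to $s$, and an $(s,t)$-core partition if it is simultaneously an $s$-core and a $t$-core. The set of $(s,s+1)$-core partitions is finite, and it is given the uniform probability distribution. *)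

(* Defs.v *)
From mathcomp Require Import all_boot all_order all_algebra.
From mathcomp Require Import finmap all_classical.
From mathcomp Require Import zify.

Set Implicit Arguments.
Unset Strict Implicit.
Unset Printing Implicit Defensive.

Import Order.TTheory GRing.Theory Num.Theory.

Definition is_partition (la : seq nat) : bool :=
  sorted geq la && (0 \notin la).

(* Rows, columns and parts are numbered from 1. *)
Definition part (la : seq nat) (i : nat) : nat := nth 0 la i.-1.

Definition conj_part (la : seq nat) (j : nat) : nat := count (leq j) la.

Definition in_diagram (la : seq nat) (i j : nat) : bool :=
  (1 <= i <= size la) && (1 <= j <= part la i).

(* On the cells of the diagram of a partition neither subtraction truncates:
   j <= part la i and i <= conj_part la j. *)
Definition hook_length (la : seq nat) (i j : nat) : nat :=
  part la i - j + conj_part la j - i + 1.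

Definition is_core (n : nat) (la : seq nat) : Prop :=
  forall i j, in_diagram la i j -> hook_length la i j <> n.

Definition cores (s t : nat) : set (seq nat) :=
  [set la | is_partition la /\ is_core s la /\ is_core t la]%classic.

(* Expectation of X under the uniform distribution on A. The value is only
   meaningful for A finite, since fset_set A is empty otherwise; for the sets
   considered here see finite_cores. *)
Definition uniform_expectation (T : choiceType) (A : set T) (X : T -> rat)
  : rat :=
  ((\sum_(x <- fset_set A) X x) / #|` fset_set A|%:R)%R.

Definition central_moment (T : choiceType) (A : set T) (X : T -> rat)
    (r : nat) : rat :=
  uniform_expectation A (fun x => (X x - uniform_expectation A X) ^+ r)%R.

Definition partition_size (la : seq nat) : rat := (sumn la)%:R%R.

Lemma count_split (la : seq nat) (p : pred nat) m : m <= size la ->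
  (forall j, j < m -> p (nth 0 la j)) ->
  (forall j, m <= j < size la -> ~~ p (nth 0 la j)) ->
  count p la = m.
Proof.
move=> mk h1 h2; rewrite -(cat_take_drop m la) count_cat.
have -> : count p (take m la) = m.
  rewrite -{2}(size_takel mk); apply/eqP; rewrite -all_count.
  by apply/(all_nthP 0) => j; rewrite size_takel // => jm; rewrite nth_take ?h1.
have -> : count p (drop m la) = 0; last by rewrite addn0.
apply/eqP; rewrite -leqn0 leqNgt -has_count; apply/(has_nthP 0) => -[j].
by rewrite size_drop nth_drop => jm; apply/negP/h2; lia.
Qed.

Definition first_col_hook (la : seq nat) (i : nat) : nat :=
  nth 0 la i + (size la - i.+1).

Lemma partition_nth_le (la : seq nat) i j :
  is_partition la -> i <= j -> j < size la -> nth 0 la j <= nth 0 la i.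
Proof.
case/andP=> hs _ ij jk.
have geq_trans : transitive geq by move=> a b c /= h1 h2; lia.
have geq_refl : reflexive geq by move=> a /=.
by apply: (sorted_leq_nth geq_trans geq_refl 0 hs); rewrite ?inE //; lia.
Qed.

Lemma partition_nth_gt0 (la : seq nat) i :
  is_partition la -> i < size la -> 0 < nth 0 la i.
Proof.
case/andP=> _ h0 ik; rewrite lt0n; apply: contraNN h0 => /eqP <-.
exact: mem_nth.
Qed.

Lemma first_col_hook_sub (la : seq nat) d i :
  is_partition la -> is_core d la -> 0 < d -> i < size la ->
  d <= first_col_hook la i ->
  exists2 j, j < size la & first_col_hook la j = first_col_hook la i - d.
Proof.
move=> hp hc d0 ik hd; set v := first_col_hook la i - d.
pose P := [pred m | (m == size la) || (first_col_hook la m <= v)].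
have exP : exists m, P m by exists (size la); rewrite /= eqxx.
case: (ex_minnP exP) => m /= Pm mmin.
have mk : m <= size la by apply: mmin; rewrite /= eqxx.
have gtm j : j < m -> v < first_col_hook la j.
  by move=> jm; rewrite ltnNge; apply/negP => h; have := mmin j; rewrite /= h orbT; lia.
have im : i < m.
  rewrite ltnNge; apply/negP => mi.
  have m_lt : m < size la by lia.
  have := partition_nth_le hp mi ik.
  by move: Pm hd; rewrite /v /first_col_hook; lia.
have [[m_lt e]|ne] : (m < size la /\ first_col_hook la m = v) \/
    (m < size la -> first_col_hook la m < v).
  have [/eqP e|] := boolP (m == size la); first by right; lia.
  by move=> /negbTE ne; move: Pm; rewrite ne /=; lia.
  by exists m.
exfalso.
have vm : size la - m <= v by move: ne; rewrite /first_col_hook; lia.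
have m1 : m.-1 < m by lia.
have gt1 := gtm _ m1.
have lei j : j < m -> nth 0 la m.-1 <= nth 0 la j.
  by move=> jm; apply: partition_nth_le => //; lia.
pose c := v - (size la - m).
have cj : conj_part la c.+1 = m.
  apply: count_split => // j hj.
    by have := lei _ hj; move: gt1; rewrite /c /first_col_hook; lia.
  have m_lt : m < size la by lia.
  have : nth 0 la j <= nth 0 la m by apply: partition_nth_le => //; lia.
  by have := ne m_lt; rewrite /c /first_col_hook; lia.
have li : c < nth 0 la i.
  by have := lei _ im; move: gt1; rewrite /c /first_col_hook; lia.
apply: (hc i.+1 c.+1); first by rewrite /in_diagram /part /=; lia.
rewrite /hook_length cj /part /=.
by move: li vm; rewrite /c /v; move: hd; rewrite /first_col_hook; lia.
Qed.

Lemma first_col_hook_bound (la : seq nat) s i :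
  0 < s -> is_partition la -> is_core s la -> is_core s.+1 la ->
  i < size la -> first_col_hook la i < s * s.+1.
Proof.
move=> s0 hp hs ht ik; rewrite ltnNge; apply/negP => hge.
have none n : forall a b j, a + b <= n -> j < size la ->
    first_col_hook la j = a * s + b * s.+1 -> False.
  elim: n => [|n IH] a b j.
    move=> ab jk; have := partition_nth_gt0 hp jk.
    have [-> ->] : a = 0 /\ b = 0 by lia.
    by rewrite /first_col_hook; lia.
  move=> ab jk e; case: a => [|a] in ab e *.
    case: b => [|b] in ab e *; first exact: (IH 0 0 j).
    have [||l lk el] := first_col_hook_sub hp ht _ jk => //; first by nia.
    by apply: (IH 0 b l) => //; nia.
  have [||l lk el] := first_col_hook_sub hp hs _ jk => //; first by nia.
  by apply: (IH a b l) => //; nia.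
set h := first_col_hook la i in hge.
have hr := ltn_pmod h s0; have hq := divn_eq h s.
apply: (none _ (h %/ s - h %% s) (h %% s) i (leqnn _) ik).
have : s <= h %/ s by rewrite leq_divRL //; nia.
by rewrite -/h; nia.
Qed.

Lemma finite_cores s : 0 < s -> finite_set (cores s s.+1).
Proof.
move=> s0; pose N := s * s.+1.
pose f (t : N.-tuple 'I_N) := [seq x <- map val t | x != 0].
apply: (@sub_finite_set _ _ [set f t | t in setT]%classic); last first.
  exact/finite_image/finite_finset.
move=> la0; pose la : seq nat := la0; rewrite -/la => -[hp [hs ht]].
clearbody la => {la0}.
have N0 : 0 < N by rewrite /N; nia.
have bd i : i < size la -> first_col_hook la i < N.
  exact: first_col_hook_bound.
clearbody N.
have sz : size la <= N.
  case: (posnP (size la)) => [->//|k0].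
  have := bd _ k0; have := partition_nth_gt0 hp k0.
  by rewrite /first_col_hook; lia.
have ltN x : x \in la -> x < N.
  move=> xla; have ik : index x la < size la by rewrite index_mem.
  by have := bd _ ik; rewrite /first_col_hook nth_index //; lia.
pose i0 : 'I_N := Ordinal N0.
exists [tuple insubd i0 (nth 0 la i) | i < N] => //; rewrite /f.
have -> : map val [tuple insubd i0 (nth 0 la i) | i < N]
    = la ++ nseq (N - size la) 0.
  apply: (@eq_from_nth _ 0).
    by rewrite size_map size_tuple size_cat size_nseq; lia.
  move=> i; rewrite size_map size_tuple => iN.
  rewrite (nth_map i0) ?size_tuple // -[i]/(val (Ordinal iN)) -tnth_nth tnth_mktuple /=.
  rewrite val_insubd nth_cat nth_nseq; case: (ltnP i (size la)) => ik.
    by rewrite ltN // mem_nth.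
  by rewrite nth_default // N0; case: ifP.
rewrite filter_cat.
have -> : [seq x <- la | x != 0] = la.
  apply/all_filterP/allP => x xla; apply/eqP => x0.
  by case/andP: hp => _; rewrite -x0 xla.
have -> : [seq x <- nseq (N - size la) 0 | x != 0] = [::].
  by apply/eqP; rewrite -[_ == _]negbK -has_filter has_nseq /= andbF.
by rewrite cats0.
Qed.

(* Main.v *)
(** Write [t = s + 1]. Reading the first-column hook lengths of an [(s, s+1)]-core
on the [t]-abacus, with [m_r] beads on runner [r], identifies the cores with the
sequences [m_0 = 0, m_1, ..., m_s = 0] of natural numbers such that
[m_{r+1} >= m_r - 1], that is with the words [z_0 ... z_s] of sum [s] whose
heights [m_r = z_0 + ... + z_{r-1} - r] are nonnegative. Twice the size of the
core is [A - B^2], where [A = sum_r m_r (t m_r + 2 r - s)] and [B = sum_r m_r]. This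
quantity makes sense for every word of length [s + 1] and sum [s], and it is
invariant under rotation; by the cycle lemma exactly one rotation of each word
has nonnegative heights, so the size may be averaged over all words instead.

Words are lattice paths, and splitting off the last step of a path to [(n, T)]
gives, for the mean [G n T] of [A^a B^b] over these paths, an equation
[(n + T) G n T - T G n (T - 1) - n G (n - 1) T = lower moments].
The operator on the left preserves polynomials filtered by weight, where
[s] and [n + T] have weight 2 and [T - n] has weight 1, and it is invertible on
those vanishing at the origin. Hence [G] is a polynomial of weight at most
[6 a + 3 b], and at [n = T = s] the eighth central moment is a polynomial in [s]
of degree at most 24. It is therefore enough to compare it with the claimed
formula for [s = 0, ..., 24], which is done by a recursion on the joint moments
of [A] and [B]. *)

From Stdlib Require Import ZArith.
Require Import Defs.
From mathcomp Require Import all_boot all_order all_algebra.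
From mathcomp Require Import finmap all_classical.
From mathcomp Require Import ssrZ zify ring.

Set Implicit Arguments.
Unset Strict Implicit.
Unset Printing Implicit Defensive.

Import Order.TTheory GRing.Theory Num.Theory.

Local Open Scope ring_scope.

(** * Words and their statistics *)

(* Words are stored backwards, the head being the last letter: the suffixes of
   [z : seq nat] are the prefixes of the word, and [comps n T] lists the words
   of n + 1 letters and sum T. *)
Definition bump_head (z : seq nat) : seq nat :=
  if z is x :: c then x.+1 :: c else [::].

Fixpoint comps (n : nat) : nat -> seq (seq nat) :=
  if n is n'.+1 then
    fix comps_n T :=
      if T is T'.+1 then
        map bump_head (comps_n T') ++ map (cons 0%N) (comps n' T)
      else map (cons 0%N) (comps n' 0%N)
  else fun T => [:: [:: T]].

(** Nonnegativity of the heights of all proper prefixes of the word. The whole word is not tested: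
    with s + 1 letters of sum s it has height -1. *)
Fixpoint good (z : seq nat) : bool :=
  if z is _ :: c then (size c <= sumn c)%N && good c else true.

Section Statistics.
Variable R : comNzRingType.

Definition height (c : seq nat) : R := (sumn c)%:R - (size c)%:R.

(** [area] and [weight] are the sums B and A over the proper prefixes of the word. The ring is
    arbitrary because they are computed over [Z] and averaged over [rat]. *)
Fixpoint area (z : seq nat) : R :=
  if z is _ :: c then area c + height c else 0.

Definition wt (s : R) (n : nat) (m : R) : R :=
  m * ((s + 1) * m + (2 * n%:R - s)).

Fixpoint weight (s : R) (z : seq nat) : R :=
  if z is _ :: c then weight s c + wt s (size c) (height c) else 0.

Definition dsize (s : R) (z : seq nat) : R := weight s z - area z ^+ 2.

Lemma area_bump z : area (bump_head z) = area z. Proof. by case: z. Qed.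
Lemma weight_bump s z : weight s (bump_head z) = weight s z.
Proof. by case: z. Qed.

End Statistics.

Lemma good_bump z : good (bump_head z) = good z. Proof. by case: z. Qed.

Lemma mem_comps n T z :
  (z \in comps n T) = (size z == n.+1) && (sumn z == T).
Proof.
elim: n T z => [|n IHn] T z.
  rewrite inE; case: z => [|x [|y c]] //=.
  by rewrite eqseq_cons addn0 andbT.
  by rewrite eqseq_cons andbF.
have cons0 T' z' : (z' \in map (cons 0%N) (comps n T')) =
    [&& head 1%N z' == 0%N, size z' == n.+2 & sumn z' == T'].
  apply/mapP/idP => [[c]|].
    by rewrite IHn => /andP[/eqP sz /eqP sm] -> /=; rewrite sz sm !eqxx.
  case: z' => [|x c] //= /and3P[/eqP-> sz sm].
  by exists c => //; rewrite IHn -eqSS sz sm.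
elim: T z => [|T IHT] z /=.
  by rewrite cons0; case: z => [|[|x] c] //=; rewrite ?andbF.
rewrite mem_cat cons0 -/(comps n.+1).
have -> : (z \in map bump_head (comps n.+1 T)) =
    [&& head 0%N z != 0%N, size z == n.+2 & sumn z == T.+1].
  apply/mapP/idP => [[c]|].
    by rewrite IHT; case: c => //= x c /andP[sz sm] -> /=; rewrite sz.
  case: z => [|[|x] c] //= /andP[sz sm].
  by exists (x :: c) => //; rewrite IHT /= sz.
by case: z => [|[|x] c] //=; rewrite ?orbF.
Qed.

Lemma uniq_comps n T : uniq (comps n T).
Proof.
have inj_cons : injective (cons 0%N) by move=> c d [].
elim: n T => [|n IHn] // T; elim: T => [|T IHT]; first by rewrite map_inj_uniq.
have inj_bump : {in comps n.+1 T &, injective bump_head}.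
  by move=> [|x c] [|y d]; rewrite !mem_comps // => _ _ [-> ->].
rewrite [comps _ _]/= -/(comps n.+1) cat_uniq (map_inj_uniq inj_cons) IHn andbT.
rewrite (map_inj_in_uniq inj_bump) IHT /=.
apply/hasPn => _ /mapP[c _ ->]; apply/mapP => -[[|x d]] //.
Qed.

Lemma size_comps n T : size (comps n T) = 'C(n + T, n).
Proof.
elim: n T => [|n IHn] T; first by rewrite bin0.
elim: T => [|T IHT]; first by rewrite size_map IHn !addn0 !binn.
rewrite /= -/(comps n.+1) size_cat !size_map IHT IHn.
by rewrite !addSn !addnS binS.
Qed.

Lemma big_comps (V : nmodType) n T (p : pred (seq nat)) (f : seq nat -> V) :
  \sum_(z <- comps n.+1 T.+1 | p z) f z =
  \sum_(z <- comps n.+1 T | p (bump_head z)) f (bump_head z) +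
  \sum_(z <- comps n T.+1 | p (0%N :: z)) f (0%N :: z).
Proof. by rewrite /= big_cat !big_map. Qed.

(** * Rotations and the cycle lemma *)

Section Rotation.
Variable R : comNzRingType.

Lemma height_rcons c x : height R (rcons c x) = height R c + (x%:R - 1).
Proof. by rewrite /height sumn_rcons size_rcons natrD -natr1; ring. Qed.

(** [rcons] adds a first letter to the word: all later heights rise by [x - 1], and the empty prefix
    contributes 0. For [weight] the index of each height also moves by one, whence the extra term
    [2 * area R c] there. *)
Lemma area_rcons c x :
  area R (rcons c x) = area R c + (size c)%:R * (x%:R - 1).
Proof.
elim: c => [|y c IH] /=; first by rewrite /height /= subrr mul0r.
by rewrite IH height_rcons -natr1; ring.
Qed.

Lemma weight_rcons (s : R) c x :
  weight s (rcons c x) = weight s c + 2 * area R c + (x%:R - 1) *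
    ((s + 1) * (2 * area R c + (size c)%:R * (x%:R - 1))
     + (size c)%:R * ((size c)%:R + 1) - (size c)%:R * s).
Proof.
elim: c => [|y c IH] /=.
  by rewrite /wt /height /= subrr; ring.
rewrite IH height_rcons size_rcons /wt -natr1; ring.
Qed.

(** Here [c] has height -x, and both sides equal W - B^2 + 2 x B + s x (x - 1), with W and B the
    weight and the area of [c]. *)
Lemma dsize_rot1 s x c : size c = s -> (sumn c + x = s)%N ->
  dsize (s%:R : R) (rcons c x) = dsize s%:R (x :: c).
Proof.
move=> sz sm; rewrite /dsize weight_rcons area_rcons /= /wt.
have -> : height R c = - x%:R.
  by rewrite /height sz -[in s%:R]sm natrD; ring.
by rewrite sz; ring.
Qed.

Lemma sumn_rot k z : sumn (rot k z) = sumn z.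
Proof. by rewrite /rot sumn_cat addnC -sumn_cat cat_take_drop. Qed.

Lemma dsize_rot s k z : size z = s.+1 -> sumn z = s ->
  dsize (s%:R : R) (rot k z) = dsize s%:R z.
Proof.
move=> sz sm; elim: k => [|k IH]; first by rewrite rot0.
case: (ltnP k (size z)) => kz; last by rewrite rot_oversize // ltnW.
rewrite rotS //.
have := size_rot k z; have := sumn_rot k z; rewrite sz sm -IH.
case: (rot k z) => [//|x c] /= sm' [sz'].
by rewrite rot1_cons dsize_rot1 // addnC.
Qed.
End Rotation.

Lemma goodP z : reflect (forall i, (0 < i <= size z)%N ->
    (size (drop i z) <= sumn (drop i z))%N) (good z).
Proof.
apply: (iffP idP) => [|H].
  elim: z => [|x c IH] /=; first by move=> _ [].
  move=> /andP[sc gc] [|[|i]] //= hi; first by rewrite drop0.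
  by apply: IH.
elim: z H => [|x c IH] //= H; apply/andP; split.
  by have := H 1%N; rewrite /= drop0; apply.
apply: IH => i hi; by apply: (H i.+1); lia.
Qed.

(* With p_j = sumn (take j z) - j, this says that k is the last index in
   {0, ..., size z} at which p is maximal. *)
Lemma good_rotP z k : size z = (sumn z).+1 -> (k < size z)%N ->
  reflect (forall j, (j <= size z)%N ->
     if (k < j)%N then (sumn (take j z) + k < sumn (take k z) + j)%N
     else (sumn (take j z) + k <= sumn (take k z) + j)%N)
   (good (rot k z)).
Proof.
move=> sz kz.
have sd j : (sumn (drop j z) = sumn z - sumn (take j z))%N.
  by rewrite -[in sumn z](cat_take_drop j z) sumn_cat addKn.
have st j : (sumn (take j z) <= sumn z)%N.
  by rewrite -[in sumn z](cat_take_drop j z) sumn_cat leq_addr.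
have dr i : drop i (rot k z) =
    if (i < size z - k)%N then drop (i + k) z ++ take k z
    else drop (i - (size z - k)) (take k z).
  by rewrite /rot drop_cat size_drop drop_drop.
have sdt j : (j <= k)%N ->
    (sumn (take k z) = sumn (take j z) + sumn (drop j (take k z)))%N.
  by move=> jk; rewrite -sumn_cat -{1}(take_takel z jk) cat_take_drop.
apply: (iffP (goodP _)) => H.
  move=> j jz; case: ifP => kj.
    have := H (j - k)%N; rewrite size_rot dr.
    case: ifP => hj.
      rewrite (subnK (ltnW kj)) size_cat sumn_cat size_drop (size_takel (ltnW kz)) sd.
      by have := st j; lia.
    have -> : (j - k - (size z - k) = 0)%N by lia.
    have -> : j = size z by lia.
    by rewrite drop0 take_size (size_takel (ltnW kz)); lia.
  have jk : (j <= k)%N by rewrite leqNgt kj.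
  case: (posnP j) => [->|j0].
    rewrite take0 /=; have := H (size z - k)%N; rewrite size_rot dr ltnn subnn drop0.
    by rewrite (size_takel (ltnW kz)); lia.
  have := H (size z - k + j)%N; rewrite size_rot dr.
  rewrite ifF; last by lia.
  rewrite addKn size_drop (size_takel (ltnW kz)) (sdt j jk); lia.
move=> i hi; rewrite size_rot in hi; rewrite dr; case: ifP => hik.
  rewrite size_cat sumn_cat size_drop (size_takel (ltnW kz)) sd.
  have := H (i + k)%N; rewrite ifT; last by lia.
  by have := st (i + k)%N; lia.
have jk : (i - (size z - k) <= k)%N by lia.
rewrite size_drop (size_takel (ltnW kz)).
have := sdt _ jk; have := H (i - (size z - k))%N; rewrite ifF; lia.
Qed.

Lemma good_rot_unique z k k' : size z = (sumn z).+1 ->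
  (k < size z)%N -> (k' < size z)%N -> good (rot k z) -> good (rot k' z) -> k = k'.
Proof.
move=> sz kz kz' /(good_rotP sz kz) H /(good_rotP sz kz') H'.
have := H _ (ltnW kz'); have := H' _ (ltnW kz).
by case: (ltngtP k k') => // _; lia.
Qed.

(** The last maximum of p is found by maximising (p_j, j) lexicographically over j < n, encoded as
    the single number [f j * n.+1 + j], where [f j] is p_j + n. The remaining index j = n is
    harmless, since p_n = -1 < p_0. *)
Lemma good_rot_exists z : size z = (sumn z).+1 ->
  exists2 k, (k < size z)%N & good (rot k z).
Proof.
move=> sz; pose n := size z.
pose f (j : nat) : nat := (sumn (take j z) + n - j)%N.
have z0 : (0 < n)%N by rewrite /n sz.
case: (arg_maxnP (fun i : 'I_n => (f i * n.+1 + i)%N) (isT : predT (Ordinal z0))).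
move=> k _ kmax; exists k => //; apply/good_rotP => // j jz.
have fmax i : (i < n)%N -> (f i * n.+1 + i <= f k * n.+1 + k)%N.
  by move=> iz; exact: (kmax (Ordinal iz)).
have kn := ltn_ord k.
have flex i : (i < n)%N -> if (k < i)%N then (f i < f k)%N else (f i <= f k)%N.
  by move=> iz; have := fmax _ iz; case: ifP => ki; nia.
move: jz; rewrite -/n leq_eqVlt => /predU1P[->|jn].
  rewrite kn take_oversize //; have := flex 0%N z0; rewrite /f take0 /=.
  by rewrite /n in kn *; lia.
by have := flex _ jn; rewrite /f; case: ifP; lia.
Qed.

Lemma perm_rot_comps s k : perm_eq (map (rot k) (comps s s)) (comps s s).
Proof.
apply: uniq_perm; rewrite ?map_inj_uniq ?uniq_comps //; first exact: rot_inj.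
move=> z; apply/mapP/idP => [[y hy ->]|hz].
  by move: hy; rewrite !mem_comps size_rot sumn_rot.
exists (rotr k z); last by rewrite rotrK.
by move: hz; rewrite -{1}[z](rotrK k) !mem_comps size_rot sumn_rot.
Qed.

(** Double counting: each word is replaced by its unique good rotation, which has the same [dsize];
    after exchanging the sums, each of the s + 1 rotations permutes the words. *)
Lemma sum_comps_good (V : comNzRingType) s (F : V -> V) :
  \sum_(z <- comps s s) F (dsize s%:R z) =
  s.+1%:R * \sum_(z <- comps s s | good z) F (dsize s%:R z).
Proof.
transitivity (\sum_(z <- comps s s) \sum_(k < s.+1)
    if good (rot k z) then F (dsize s%:R (rot k z)) else 0).
  rewrite big_seq [RHS]big_seq; apply: eq_bigr => z.
  rewrite mem_comps => /andP[/eqP sz /eqP sm].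
  have sz' : size z = (sumn z).+1 by rewrite sm.
  have [k kz gk] := good_rot_exists sz'; rewrite sz in kz.
  rewrite (bigD1 (Ordinal kz)) //= gk dsize_rot // big1 ?addr0 // => i ik.
  case: ifP => // gi; case/eqP: ik; apply: val_inj => /=.
  by apply: (good_rot_unique sz') => //; rewrite sz.
rewrite exchange_big /= mulr_natl -[s.+1 in RHS]card_ord -sumr_const.
apply: eq_bigr => k _.
rewrite -(big_map (rot k) xpredT (fun z => if good z then F (dsize s%:R z) else 0)).
by rewrite (perm_big _ (perm_rot_comps s k)) -big_mkcond.
Qed.

(** * Weighted polynomials *)

Definition fun3 := rat -> rat -> rat -> rat.

(** Polynomial functions of s, N = n + T and D = T - n. The weight is at most [k], and the degree in
    N and D alone is less than [d]; the inversion of [Lop] goes by induction on this degree. *)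
Inductive wpoly (k d : nat) : fun3 -> Prop :=
| Wzero f : (forall s N D, f s N D = 0) -> wpoly k d f
| Wmono c i j l f : (i.*2 + j.*2 + l <= k)%N -> (j + l < d)%N ->
    (forall s N D, f s N D = c * s ^+ i * N ^+ j * D ^+ l) -> wpoly k d f
| Wadd f g h : wpoly k d f -> wpoly k d g ->
    (forall s N D, h s N D = f s N D + g s N D) -> wpoly k d h.

Lemma wpoly_ext k d f g : (forall s N D, f s N D = g s N D) ->
  wpoly k d g -> wpoly k d f.
Proof.
by move=> e Wg; apply: (Wadd Wg (Wzero _ _ (f := fun _ _ _ => 0) _)) => // s N D;
  rewrite e addr0.
Qed.

Lemma wpoly_le k k' d d' f : (k <= k')%N -> (d <= d')%N ->
  wpoly k d f -> wpoly k' d' f.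
Proof.
move=> kk dd; elim=> {f} [f e|c i j l f ek ed e|f g h _ Wf _ Wg e].
- exact: Wzero.
- by apply: (@Wmono _ _ c i j l) => //; lia.
- exact: Wadd e.
Qed.

Lemma wpoly_mul k k' d d' f g : wpoly k d f -> wpoly k' d' g ->
  wpoly (k + k') (d + d') (fun s N D => f s N D * g s N D).
Proof.
move=> Wf Wg; elim: Wf => {f} [f e|c i j l f ek ed e|f f' h _ Wf _ Wf' e].
- by apply: Wzero => s N D; rewrite e mul0r.
- elim: Wg => {g} [g e'|c' i' j' l' g ek' ed' e'|g g' h _ Wg _ Wg' e'].
  + by apply: Wzero => s N D; rewrite e' mulr0.
  + apply: (@Wmono _ _ (c * c') (i + i') (j + j') (l + l')); try lia.
    by move=> s N D; rewrite e e' !exprD; ring.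
  + by apply: (Wadd Wg Wg') => s N D; rewrite e' mulrDr.
- by apply: (Wadd Wf Wf') => s N D; rewrite e mulrDl.
Qed.

Lemma wpoly_cst c k d : wpoly k d.+1 (fun _ _ _ => c).
Proof. by apply: (@Wmono _ _ c 0 0 0) => // s N D; rewrite !expr0 !mulr1. Qed.

Lemma wpoly_scale c k d f : wpoly k d f -> wpoly k d (fun s N D => c * f s N D).
Proof.
elim=> {f} [f e|a i j l f ek ed e|f g h _ Wf _ Wg e].
- by apply: Wzero => s N D; rewrite e mulr0.
- by apply: (@Wmono _ _ (c * a) i j l) => // s N D; rewrite e !mulrA.
- by apply: (Wadd Wf Wg) => s N D; rewrite e mulrDr.
Qed.

Lemma wpoly_sub k d f g : wpoly k d f -> wpoly k d g ->
  wpoly k d (fun s N D => f s N D - g s N D).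
Proof.
move=> Wf Wg; apply: (Wadd Wf (wpoly_scale (-1) Wg)) => s N D.
by rewrite mulN1r.
Qed.

Lemma wpoly_mono_mul k d i j l f : wpoly k d f ->
  wpoly (i.*2 + j.*2 + l + k) (j + l + d)
    (fun s N D => s ^+ i * N ^+ j * D ^+ l * f s N D).
Proof.
elim=> {f} [f e|c i' j' l' f ek ed e|f g h _ Wf _ Wg e].
- by apply: Wzero => s N D; rewrite e mulr0.
- apply: (@Wmono _ _ c (i + i') (j + j') (l + l')); try lia.
  by move=> s N D; rewrite e !exprD; ring.
- by apply: (Wadd Wf Wg) => s N D; rewrite e mulrDr.
Qed.

Lemma wpoly_mulN k d f : wpoly k d f ->
  wpoly k.+2 d.+1 (fun s N D => N * f s N D).
Proof.
move=> W; apply: (wpoly_ext _ (wpoly_mono_mul 0 1 0 W)) => s N D.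
by rewrite expr0 expr1 mulr1 mul1r.
Qed.

Lemma wpoly_mulD k d f : wpoly k d f ->
  wpoly k.+1 d.+1 (fun s N D => D * f s N D).
Proof.
move=> W; apply: (wpoly_ext _ (wpoly_mono_mul 0 0 1 W)) => s N D.
by rewrite expr0 expr1 !mul1r.
Qed.

(* In the coordinates N = n + T, D = T - n this is
   [(n + T) f n T - T f n (T - 1) - n f (n - 1) T]. *)
Definition Lop (f : fun3) : fun3 := fun s N D =>
  N * f s N D - (N + D) / 2 * f s (N - 1) (D - 1)
              - (N - D) / 2 * f s (N - 1) (D + 1).

(** The companion of [Lop] under multiplication by D: Lop (D f) = D Lop f + Mop f and Mop (D f) = D
    Mop f - N f + Lop f. *)
Definition Mop (f : fun3) : fun3 := fun s N D =>
  (N + D) / 2 * f s (N - 1) (D - 1) - (N - D) / 2 * f s (N - 1) (D + 1).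

Definition mono (j l : nat) : fun3 := fun _ N D => N ^+ j * D ^+ l.

(** To leading degree [Lop] is the Euler operator N d/dN + D d/dD, with eigenvalue j + l on N^j D^l,
    and [Mop] is multiplication by D. The error terms have smaller degree and no larger weight. The
    induction on l mixes the two operators, so both claims are proved together. *)
Lemma wpoly_Lop_mono j l :
  wpoly (j.*2 + l) (j + l)
    (fun s N D => Lop (mono j l) s N D - (j + l)%:R * mono j l s N D) /\
  wpoly (j.*2 + l).+1 (j + l).+1
    (fun s N D => Mop (mono j l) s N D - D * mono j l s N D).
Proof.
have Wm i m : wpoly (i.*2 + m) (i + m).+1 (mono i m).
  by apply: (@Wmono _ _ 1 0 i m) => // s N D; rewrite expr0 !mul1r.
elim: j => [|j [IHL IHM]].
  elim: l => [|l [IHL IHM]].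
    by split; apply: Wzero => s N D; rewrite /Lop /Mop /mono !expr0; field.
  have EL s N D : Lop (mono 0 l.+1) s N D =
      D * Lop (mono 0 l) s N D + Mop (mono 0 l) s N D.
    by rewrite /Lop /Mop /mono !exprS !expr0; field.
  have EM s N D : Mop (mono 0 l.+1) s N D =
      D * Mop (mono 0 l) s N D - N * mono 0 l s N D + Lop (mono 0 l) s N D.
    by rewrite /Lop /Mop /mono !exprS !expr0; field.
  split.
    apply: (Wadd (wpoly_mulD IHL) IHM) => s N D.
    by rewrite EL !add0n -natr1 /mono !exprS; ring.
  have W1 := wpoly_sub (wpoly_mulD IHM) (wpoly_mulN (Wm 0%N l)).
  have W2 : wpoly (0.*2 + l.+1).+1 (0 + l.+1).+1 (Lop (mono 0 l)).
    have Wl := wpoly_scale (0 + l)%:R (Wm 0%N l).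
    apply: (Wadd (wpoly_le _ _ IHL) (wpoly_le _ _ Wl)); try lia.
    by move=> s N D; rewrite subrK.
  apply: (Wadd W1 W2) => s N D.
  by rewrite EM /mono !exprS !expr0; ring.
have EL s N D : Lop (mono j.+1 l) s N D =
    (N - 1) * Lop (mono j l) s N D + N * mono j l s N D.
  by rewrite /Lop /mono !exprS; field.
have EM s N D : Mop (mono j.+1 l) s N D = (N - 1) * Mop (mono j l) s N D.
  by rewrite /Mop /mono !exprS; field.
split.
  have W1 : wpoly (j.+1.*2 + l) (j.+1 + l) (fun s N D =>
      N * (Lop (mono j l) s N D - (j + l)%:R * mono j l s N D) -
          (Lop (mono j l) s N D - (j + l)%:R * mono j l s N D)).
    apply: wpoly_sub; first by apply: wpoly_le (wpoly_mulN IHL); lia.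
    by apply: wpoly_le IHL; lia.
  have W2 : wpoly (j.+1.*2 + l) (j.+1 + l)
      (fun s N D => - (j + l)%:R * mono j l s N D).
    by apply: wpoly_scale; apply: wpoly_le (Wm j l); lia.
  apply: (Wadd W1 W2) => s N D.
  by rewrite EL addSn -natr1 /mono !exprS; ring.
have W1 : wpoly (j.+1.*2 + l).+1 (j.+1 + l).+1 (fun s N D =>
    N * (Mop (mono j l) s N D - D * mono j l s N D) -
        (Mop (mono j l) s N D - D * mono j l s N D)).
  apply: wpoly_sub; first by apply: wpoly_le (wpoly_mulN IHM); lia.
  by apply: wpoly_le IHM; lia.
have W2 : wpoly (j.+1.*2 + l).+1 (j.+1 + l).+1
    (fun s N D => - 1 * (D * mono j l s N D)).
  by apply: wpoly_scale; apply: wpoly_le (wpoly_mulD (Wm j l)); lia.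
apply: (Wadd W1 W2) => s N D.
by rewrite EM /mono !exprS; ring.
Qed.

(** Monomials of top degree d + 1 are divided by their eigenvalue, which is not zero; those of lower
    degree are left in the remainder. *)
Lemma Lop_sub_top k d f : wpoly k d.+2 f ->
  exists2 g, wpoly k d.+2 g & wpoly k d.+1 (fun s N D => f s N D - Lop g s N D).
Proof.
elim=> {f} [f e|c i j l f ek ed e|f f' h _ [g Wg Wr] _ [g' Wg' Wr'] e].
- exists (fun _ _ _ => 0); first exact: Wzero.
  by apply: Wzero => s N D; rewrite e /Lop !mulr0 !subr0.
- case: (ltnP (j + l) d.+1) => jl.
    exists (fun _ _ _ => 0); first exact: Wzero.
    apply: (@Wmono _ _ c i j l) => // s N D.
    by rewrite e /Lop !mulr0 !subr0.
  have djl : (j + l)%N = d.+1 by lia.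
  have d0 : (d.+1)%:R != 0 :> rat by rewrite pnatr_eq0.
  exists (fun s N D => c / d.+1%:R * s ^+ i * mono j l s N D).
    by apply: (@Wmono _ _ (c / d.+1%:R) i j l) => // s N D; rewrite /mono mulrA.
  have [W _] := wpoly_Lop_mono j l.
  have {}W := wpoly_scale (- (c / d.+1%:R)) (wpoly_mono_mul i 0 0 W).
  apply: (wpoly_ext _ (wpoly_le _ _ W)); [|lia|lia].
  move=> s N D; rewrite e djl /Lop /mono expr0 mulr1.
  by move: (d.+1%:R : rat) d0 => w w0; field.
- exists (fun s N D => g s N D + g' s N D); first exact: (Wadd Wg Wg').
  by apply: (Wadd Wr Wr') => s N D; rewrite e /Lop; ring.
Qed.

Lemma Lop_origin g s : Lop g s 0 0 = 0.
Proof. by rewrite /Lop; field. Qed.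

Lemma wpoly1_const k f s N D : wpoly k 1 f -> f s N D = f s 0 0.
Proof.
elim=> {f} [f e|c i j l f ek ed e|f g h _ Wf _ Wg e]; rewrite !e ?Wf ?Wg //.
have [-> ->] : j = 0%N /\ l = 0%N by lia.
by rewrite !expr0.
Qed.

(** Removing top degrees one after the other leaves a function of s alone. It is zero, because [f]
    and every value of [Lop] vanish at N = D = 0. *)
Lemma Lop_surj k d f : wpoly k d.+1 f -> (forall s, f s 0 0 = 0) ->
  exists2 g, wpoly k d.+1 g & forall s N D, Lop g s N D = f s N D.
Proof.
elim: d f => [|d IH] f Wf f0.
  exists (fun _ _ _ => 0); first exact: Wzero.
  by move=> s N D; rewrite (wpoly1_const _ _ _ Wf) f0 /Lop !mulr0 !subr0.
have [g Wg Wr] := Lop_sub_top Wf.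
have [s|h Wh eh] := IH _ Wr; first by rewrite f0 Lop_origin subr0.
exists (fun s N D => g s N D + h s N D).
  by apply: (Wadd Wg (wpoly_le _ _ Wh)).
move=> s N D; have := eh s N D; rewrite /Lop => e.
transitivity (Lop g s N D + Lop h s N D); first by rewrite /Lop; ring.
by rewrite [Lop h _ _ _]e /Lop; ring.
Qed.

Definition wp (k : nat) (f : fun3) : Prop := exists d, wpoly k d f.

Lemma wp_ext k f g : (forall s N D, f s N D = g s N D) -> wp k g -> wp k f.
Proof. by move=> e [d W]; exists d; exact: wpoly_ext e W. Qed.

Lemma wp_le k k' f : (k <= k')%N -> wp k f -> wp k' f.
Proof. by move=> kk [d W]; exists d; exact: wpoly_le W. Qed.

Lemma wp_cst c k : wp k (fun _ _ _ => c).
Proof. by exists 1%N; exact: wpoly_cst. Qed.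

Lemma wp_add k f g : wp k f -> wp k g -> wp k (fun s N D => f s N D + g s N D).
Proof.
move=> [d Wf] [d' Wg]; exists (maxn d d').
apply: (Wadd (wpoly_le _ _ Wf) (wpoly_le _ _ Wg)) => //.
  exact: leq_maxl.
exact: leq_maxr.
Qed.

Lemma wp_mul k k' f g : wp k f -> wp k' g ->
  wp (k + k') (fun s N D => f s N D * g s N D).
Proof. by move=> [d Wf] [d' Wg]; exists (d + d')%N; exact: wpoly_mul. Qed.

Lemma wp_opp k f : wp k f -> wp k (fun s N D => - f s N D).
Proof.
by move=> /(wp_mul (wp_cst (-1) 0)); apply: wp_ext => s N D; rewrite mulN1r.
Qed.

Lemma wp_sub k f g : wp k f -> wp k g -> wp k (fun s N D => f s N D - g s N D).
Proof. by move=> Wf /wp_opp; exact: wp_add. Qed.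

Lemma wp_exp k f i : wp k f -> wp (k * i) (fun s N D => f s N D ^+ i).
Proof.
move=> Wf; elim: i => [|i IH]; first exact: wp_cst.
rewrite mulnS; apply: wp_ext (wp_mul Wf IH) => s N D; exact: exprS.
Qed.

Lemma wp_s : wp 2 (fun s _ _ => s).
Proof.
by exists 1%N; apply: (@Wmono _ _ 1 1 0 0) => // s N D; rewrite !mulr1 mul1r.
Qed.

Lemma wp_N : wp 2 (fun _ N _ => N).
Proof.
by exists 2%N; apply: (@Wmono _ _ 1 0 1 0) => // s N D; rewrite !mulr1 mul1r.
Qed.

Lemma wp_D : wp 1 (fun _ _ D => D).
Proof.
by exists 2%N; apply: (@Wmono _ _ 1 0 0 1) => // s N D; rewrite !mulr1 mul1r.
Qed.

Lemma wp_comp k f p q : wp 2 p -> wp 1 q -> wp k f ->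
  wp k (fun s N D => f s (p s N D) (q s N D)).
Proof.
move=> Wp Wq [d]; elim=> {f} [f e|c i j l f ek ed e|f g h _ Wf _ Wg e].
- by apply: wp_ext (wp_cst 0 k) => s N D; rewrite e.
- have W := wp_mul (wp_mul (wp_mul (wp_cst c 0) (wp_exp i wp_s)) (wp_exp j Wp))
                   (wp_exp l Wq).
  by apply: (wp_ext _ (wp_le _ W)) => [s N D|]; [rewrite e | lia].
- by apply: wp_ext (wp_add Wf Wg) => s N D; rewrite e.
Qed.

Lemma wp_origin k f : wp k f -> wp k (fun s _ _ => f s 0 0).
Proof. by apply: wp_comp; exact: wp_cst. Qed.

(** * Moments over lattice paths *)

(* [u s n T] stands for a sum over the 'C(n + T, n) lattice paths to (n, T). *)
Definition rep (k : nat) (u : nat -> nat -> nat -> rat) : Prop :=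
  exists2 G, wp k G & forall s n T : nat,
    u s n T = 'C(n + T, n)%:R * G s%:R (n + T)%:R (T%:R - n%:R).

Lemma rep_le k k' u : (k <= k')%N -> rep k u -> rep k' u.
Proof. by move=> kk [G WG e]; exists G => //; exact: wp_le WG. Qed.

Lemma rep_ext k u u' : (forall s n T, u s n T = u' s n T) -> rep k u' -> rep k u.
Proof. by move=> e [G WG eG]; exists G => // s n T; rewrite e eG. Qed.

Lemma rep0 k : rep k (fun _ _ _ => 0).
Proof.
by exists (fun _ _ _ => 0); [exact: wp_cst | move=> *; rewrite mulr0].
Qed.

Lemma rep_add k u u' : rep k u -> rep k u' ->
  rep k (fun s n T => u s n T + u' s n T).
Proof.
move=> [G WG e] [G' WG' e']; exists (fun s N D => G s N D + G' s N D).
  exact: wp_add.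
by move=> s n T; rewrite e e' mulrDr.
Qed.

Lemma rep_sum k (I : eqType) (r : seq I) (P : pred I) u :
  (forall i, P i -> rep k (u i)) ->
  rep k (fun s n T => \sum_(i <- r | P i) u i s n T).
Proof.
move=> H; elim: r => [|i r IH].
  by apply: rep_ext (rep0 k) => s n T; rewrite big_nil.
case: (boolP (P i)) => Pi; last first.
  by apply: rep_ext IH => s n T; rewrite big_cons (negbTE Pi).
by apply: rep_ext (rep_add (H _ Pi) IH) => s n T; rewrite big_cons Pi.
Qed.

Lemma rep_mul k k' f u : wp k f -> rep k' u ->
  rep (k + k') (fun s n T => f s%:R (n + T)%:R (T%:R - n%:R) * u s n T).
Proof.
move=> Wf [G WG e]; exists (fun s N D => f s N D * G s N D); first exact: wp_mul.
by move=> s n T; rewrite e mulrCA.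
Qed.

Definition path_moment (a b s n T : nat) : rat :=
  \sum_(z <- comps n T) weight s%:R z ^+ a * area rat z ^+ b.

(** The contribution to the moments at (n + 1, T) of the words with last letter 0: this letter turns
    a word of [comps n T] into a proper prefix, whose height is [m]. *)
Definition moved_moment (a b s n T : nat) : rat :=
  let m := T%:R - n.+1%:R in
  \sum_(z <- comps n T)
    (weight s%:R z + wt s%:R n.+1 m) ^+ a * (area rat z + m) ^+ b.

Lemma sum_cons0 a b s n T :
  \sum_(z <- comps n T) weight s%:R (0%N :: z) ^+ a * area rat (0%N :: z) ^+ b =
  moved_moment a b s n T.
Proof.
rewrite big_seq [RHS]big_seq; apply: eq_bigr => z.
by rewrite mem_comps => /andP[/eqP sz /eqP sm]; rewrite /= /height sz sm.
Qed.

Lemma path_moment0n a b s T : path_moment a b s 0 T = 0 ^+ a * 0 ^+ b.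
Proof. by rewrite /path_moment big_seq1 /= /wt /height /= subrr !mul0r !addr0. Qed.

Lemma path_momentn0 a b s n :
  path_moment a b s n.+1 0 = moved_moment a b s n 0.
Proof. by rewrite -sum_cons0 /path_moment big_map. Qed.

Lemma path_momentS a b s n T : path_moment a b s n.+1 T.+1 =
  path_moment a b s n.+1 T + moved_moment a b s n T.+1.
Proof.
rewrite -sum_cons0 /path_moment big_comps; congr (_ + _).
by apply: eq_bigr => z _; rewrite weight_bump area_bump.
Qed.

(** Binomial expansion of both powers. The term (0, 0) is isolated because all others involve
    moments with a smaller a + b. *)
Lemma moved_momentE a b s n T :
  moved_moment a b s n T = path_moment a b s n T +
  \sum_(p : 'I_a.+1 * 'I_b.+1 | p != (ord0, ord0))
    'C(a, p.1)%:R * 'C(b, p.2)%:R * wt s%:R n.+1 (T%:R - n.+1%:R) ^+ p.1 *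
    (T%:R - n.+1%:R) ^+ p.2 * path_moment (a - p.1) (b - p.2) s n T.
Proof.
set m := T%:R - _; set v := wt _ _ _.
pose F (p : 'I_a.+1 * 'I_b.+1) := 'C(a, p.1)%:R * 'C(b, p.2)%:R * v ^+ p.1 *
  m ^+ p.2 * path_moment (a - p.1) (b - p.2) s n T.
transitivity (\sum_p F p); last first.
  rewrite (bigD1 (ord0, ord0)) //=; congr (_ + _).
  by rewrite /F /= !bin0 !subn0 !expr0 !mul1r.
rewrite /F /path_moment; under [RHS]eq_bigr do rewrite mulr_sumr.
rewrite exchange_big; apply: eq_bigr => z _ /=.
rewrite !exprDn big_distrlr /= pair_bigA; apply: eq_bigr => p _ /=.
by rewrite -[X in X * _ = _]mulr_natl -[X in _ * X = _]mulr_natl; ring.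
Qed.

(* The weight of the step from (n, T) to (n + 1, T), in the coordinates of
   (n, T). *)
Definition wt_poly : fun3 := fun s N D =>
  (D - 1) * ((s + 1) * (D - 1) + (N - D + 2 - s)).

Lemma wp_D1 : wp 1 (fun _ _ D => D - 1).
Proof. by apply: wp_sub; [exact: wp_D | exact: wp_cst]. Qed.

Lemma wp_wt_poly : wp 4 wt_poly.
Proof.
apply: (wp_mul wp_D1 (k' := 3)); apply: wp_add.
  apply: (wp_mul (k := 2) _ wp_D1); apply: wp_add; first exact: wp_s.
  exact: wp_cst.
apply: (wp_le (k := 2)) => //; apply: wp_sub; last exact: wp_s.
apply: wp_add; last exact: wp_cst.
apply: wp_sub; first exact: wp_N.
exact: wp_le wp_D.
Qed.

Lemma wt_polyE (s n T : nat) :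
  wt_poly s%:R (n + T)%:R (T%:R - n%:R) = wt s%:R n.+1 (T%:R - n.+1%:R :> rat).
Proof. by rewrite /wt_poly /wt -natr1 natrD; ring. Qed.

(** Induction on a + b. In the expansion, i factors A and j factors B are traded for a polynomial of
    weight 4 i + j instead of 6 i + 3 j, a gain of at least 2; this pays for the factor n = (N - D)
    / 2 in the equation for the mean. [Lop_surj] solves that equation, and an induction on n and T
    shows that its solution is the mean. *)
Lemma rep_path_moment a b : rep (6 * a + 3 * b) (path_moment a b).
Proof.
have [m] := ubnP (a + b); elim: m a b => // m IH a b abm.
case: (posnP (a + b)) => [/eqP|ab0].
  rewrite addn_eq0 => /andP[/eqP-> /eqP->]; exists (fun _ _ _ => 1).
    exact: wp_cst.
  move=> s n T; rewrite mulr1 -size_comps /path_moment.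
  under eq_bigr do rewrite !expr0 mulr1.
  by rewrite big_const_seq count_predT iter_addr_0.
have [H WH eH] : rep (6 * a + 3 * b - 2)
    (fun s n T => moved_moment a b s n T - path_moment a b s n T).
  apply: (rep_ext (u' := fun s n T => \sum_(p : 'I_a.+1 * 'I_b.+1 | p != (ord0, ord0))
    'C(a, p.1)%:R * 'C(b, p.2)%:R * wt s%:R n.+1 (T%:R - n.+1%:R) ^+ p.1 *
    (T%:R - n.+1%:R) ^+ p.2 * path_moment (a - p.1) (b - p.2) s n T)).
    by move=> s n T; rewrite moved_momentE addrC addKr.
  apply: rep_sum => -[i j] ij; have ij0 : (0 < i + j)%N.
    rewrite lt0n addn_eq0; apply: contraNN ij => /andP[/eqP i0 /eqP j0].
    by rewrite xpair_eqE -!val_eqE /= i0 j0.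
  have ia := ltn_ord i; have jb := ltn_ord j; rewrite /= in ij *.
  have ab_lt : (a - i + (b - j) < m)%N by lia.
  have W := wp_mul (wp_mul (wp_cst ('C(a, i)%:R * 'C(b, j)%:R) 0)
                     (wp_exp i wp_wt_poly)) (wp_exp j wp_D1).
  have := rep_mul W (IH _ _ ab_lt) => /(rep_le (k' := 6 * a + 3 * b - 2)) HH.
  apply: rep_ext (HH _); last by lia.
  move=> s n T; rewrite wt_polyE; congr (_ * _ ^+ _ * _).
  by rewrite -natr1; ring.
have [d Wf] : wp (6 * a + 3 * b) (fun s N D => (N - D) / 2 * H s (N - 1) (D + 1)).
  apply: (wp_le (k := 2 + (6 * a + 3 * b - 2))); first by lia.
  apply: wp_mul.
    exact: wp_mul (wp_sub wp_N (wp_le _ wp_D)) (wp_cst 2^-1 0).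
  apply: wp_comp WH; first by apply: wp_sub; [exact: wp_N | exact: wp_cst].
  by apply: wp_add; [exact: wp_D | exact: wp_cst].
have {}Wf := wpoly_le (leqnn _) (leqnSn d) Wf.
have [s|G0 WG0 eG0] := Lop_surj Wf; first by rewrite subrr !mul0r.
(* [Lop] kills functions of s alone, so the solution may be normalised to vanish at the origin, as
   the moments with a + b > 0 do. *)
pose G : fun3 := fun s N D => G0 s N D - G0 s 0 0.
have LG s N D : N * G s N D = (N + D) / 2 * G s (N - 1) (D - 1)
     + (N - D) / 2 * (G s (N - 1) (D + 1) + H s (N - 1) (D + 1)).
  have /= e := eG0 s N D.
  by rewrite [X in _ + X]mulrDr -e /Lop /G; field.
exists G; first by apply: wp_sub; [|apply: wp_origin]; exists d.+1.
move=> s; elim=> [|n IHn] T.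
  rewrite path_moment0n bin0 mul1r add0n subr0.
  have -> : 0 ^+ a * 0 ^+ b = 0 :> rat.
    rewrite !expr0n; case: a b ab0 {IH abm H WH eH Wf eG0 LG WG0} => [|?] [|?] //;
      by rewrite ?mulr0 ?mul0r.
  (* On the axis n = 0 one has N = D: the second term of the recursion drops out and the value 0
     propagates from the origin. *)
  elim: T => [|T IHT]; first by rewrite /G subrr.
  have := LG s%:R T.+1%:R T.+1%:R; rewrite subrr !mul0r addr0 -natr1 addrK -IHT mulr0.
  by move=> /eqP; rewrite mulf_eq0 natr1 pnatr_eq0 /= => /eqP ->.
elim: T => [|T IHT].
  rewrite path_momentn0.
  have := eH s n 0%N; move/eqP; rewrite subr_eq IHn => /eqP ->.
  rewrite !addn0 !binn !mul1r !sub0r.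
  have := LG s%:R n.+1%:R (- n.+1%:R); rewrite subrr !mul0r add0r opprK.
  rewrite (_ : (_ + _) / 2 = n.+1%:R); last by field.
  move/(mulfI _) ->; last by rewrite pnatr_eq0.
  by rewrite -natr1 addrK opprD addrNK addrC.
rewrite path_momentS IHT.
have := eH s n T.+1; move/eqP; rewrite subr_eq IHn => /eqP ->.
have := LG s%:R (n.+1 + T.+1)%:R (T.+1%:R - n.+1%:R).
rewrite (_ : (_ + (_ - _)) / 2 = T.+1%:R); last by rewrite natrD; field.
rewrite (_ : (_ - (_ - _)) / 2 = n.+1%:R); last by rewrite natrD; field.
have -> : (n.+1 + T.+1)%:R - 1 = (n + T).+1%:R :> rat.
  by rewrite !addSn addnS -natr1 addrK.
have -> : T.+1%:R - n.+1%:R - 1 = T%:R - n.+1%:R :> rat by rewrite -natr1; ring.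
have -> : T.+1%:R - n.+1%:R + 1 = T.+1%:R - n%:R :> rat.
  by rewrite -(natr1 n); ring.
rewrite addSn addnS.
set g := G _ _ _; set g1 := G _ _ _; set g2 := G _ _ _; set h := H _ _ _ => E.
(* Among the paths to (n + 1, T + 1), the two kinds of last step occur in the proportions T + 1 and
   n + 1 out of n + T + 2; this turns the recursion for means into the one for sums. *)
have c1 := mul_bin_down (n + T).+2 n.+1; have c2 := mul_bin_diag (n + T).+2 n.
have {}c1 : (n + T).+2%:R * 'C((n + T).+1, n.+1)%:R =
    T.+1%:R * 'C((n + T).+2, n.+1)%:R :> rat.
  by rewrite -!natrM c1; congr (_ * _)%:R; lia.
have {}c2 : (n + T).+2%:R * 'C((n + T).+1, n)%:R =
    n.+1%:R * 'C((n + T).+2, n.+1)%:R :> rat by rewrite -!natrM c2.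
apply: (@mulfI _ (n + T).+2%:R); first by rewrite pnatr_eq0.
rewrite [RHS]mulrCA E !mulrDr !mulrA c1 c2; ring.
Qed.

(** * Polynomial dependence on s and interpolation *)

Definition upoly (d : nat) (f : nat -> rat) : Prop :=
  exists2 p : {poly rat}, (size p <= d.+1)%N & forall s, f s = p.[s%:R].

Lemma upoly_ext d f g : f =1 g -> upoly d g -> upoly d f.
Proof. by move=> e [p sp ep]; exists p => // s; rewrite e. Qed.

Lemma upoly_le d d' f : (d <= d')%N -> upoly d f -> upoly d' f.
Proof. by move=> dd [p sp ep]; exists p => //; exact: leq_trans sp _. Qed.

Lemma upoly_cst c d : upoly d (fun=> c).
Proof.
exists c%:P; first by rewrite (leq_trans (size_polyC_leq1 _)).
by move=> s; rewrite hornerC.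
Qed.

Lemma upoly_id : upoly 1 (fun s => s%:R).
Proof. by exists 'X; [rewrite size_polyX | move=> s; rewrite hornerX]. Qed.

Lemma upoly_add d f g : upoly d f -> upoly d g -> upoly d (fun s => f s + g s).
Proof.
move=> [p sp ep] [q sq eq]; exists (p + q).
  by rewrite (leq_trans (size_polyD _ _)) // geq_max sp.
by move=> s; rewrite hornerD ep eq.
Qed.

Lemma upoly_mul d d' f g : upoly d f -> upoly d' g ->
  upoly (d + d') (fun s => f s * g s).
Proof.
move=> [p sp ep] [q sq eq]; exists (p * q).
  by apply: leq_trans (size_polyMleq _ _) _; lia.
by move=> s; rewrite hornerM ep eq.
Qed.

Lemma upoly_opp d f : upoly d f -> upoly d (fun s => - f s).
Proof.
by move=> [p sp ep]; exists (- p); rewrite ?size_polyN // => s; rewrite hornerN ep.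
Qed.

Lemma upoly_sub d f g : upoly d f -> upoly d g -> upoly d (fun s => f s - g s).
Proof. by move=> Uf /upoly_opp; exact: upoly_add. Qed.

Lemma upoly_exp d f i : upoly d f -> upoly (d * i) (fun s => f s ^+ i).
Proof.
move=> Uf; elim: i => [|i IH]; first exact: upoly_cst.
by rewrite mulnS; apply: upoly_ext (upoly_mul Uf IH) => s; exact: exprS.
Qed.

Lemma upoly_eq d f g : upoly d f -> upoly d g ->
  (forall s, (s <= d)%N -> f s = g s) -> f =1 g.
Proof.
move=> Uf Ug fg s; have [p sp ep] := upoly_sub Uf Ug.
apply/eqP; rewrite -subr_eq0 ep; suff -> : p = 0 by rewrite horner0.
apply: (@roots_geq_poly_eq0 _ _ (map (fun i : nat => i%:R) (iota 0 d.+1))).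
- apply/allP => x /mapP[i]; rewrite mem_iota => /andP[_ id] ->.
  by rewrite /root -ep fg ?subrr.
- rewrite map_inj_uniq ?iota_uniq // => i j /eqP.
  by rewrite eqr_nat => /eqP.
- by rewrite size_map size_iota.
Qed.

(** At n = T = s one has N = 2 s and D = 0, so each degree in s costs weight 2. *)
Lemma upoly_wpoly k d f : wp k f -> (k <= d.*2)%N ->
  upoly d (fun s => f s%:R (s + s)%:R 0).
Proof.
move=> [e]; elim=> {f} [f ef|c i j l f ek ed ef|f g h _ Uf _ Ug eh] kd.
- by apply: upoly_ext (upoly_cst 0 d) => s; rewrite ef.
- have U := upoly_mul (upoly_mul (upoly_mul (upoly_cst c 0) (upoly_exp i upoly_id))
     (upoly_exp j (upoly_mul (upoly_cst 2 0) upoly_id))) (upoly_cst (0 ^+ l) 0).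
  apply: (upoly_ext _ (upoly_le _ U)); last by lia.
  by move=> s; rewrite ef natrD -mulr2n mulr_natl.
- by apply: upoly_ext (upoly_add (Uf kd) (Ug kd)) => s; rewrite eh.
Qed.

Definition path_mean (s : nat) (F : seq nat -> rat) : rat :=
  (\sum_(z <- comps s s) F z) / (size (comps s s))%:R.

Lemma size_comps_neq0 s : (size (comps s s))%:R != 0 :> rat.
Proof. by rewrite size_comps pnatr_eq0 -lt0n bin_gt0 leq_addr. Qed.

Lemma upoly_path_moment a c :
  upoly (3 * (a + c)) (fun s => path_mean s (fun z =>
    weight s%:R z ^+ a * area rat z ^+ c.*2)).
Proof.
have [G WG eG] := rep_path_moment a c.*2.
apply: (upoly_ext _ (upoly_wpoly WG _)); last by lia.
move=> s; have := eG s s s; rewrite /path_moment /path_mean => ->.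
by rewrite subrr -size_comps mulrC mulKf ?size_comps_neq0.
Qed.

Lemma path_meanB s F G :
  path_mean s (fun z => F z - G z) = path_mean s F - path_mean s G.
Proof. by rewrite /path_mean sumrB mulrBl. Qed.

Lemma path_meanZ s c F : path_mean s (fun z => c * F z) = c * path_mean s F.
Proof. by rewrite /path_mean -mulr_sumr mulrA. Qed.

Lemma eq_path_mean s F G : F =1 G -> path_mean s F = path_mean s G.
Proof. by move=> e; rewrite /path_mean (eq_bigr _ (fun z _ => e z)). Qed.

(** A, B^2 and [mu] each count for degree 3, so the factors A - B^2 - [mu] can be expanded one at a
    time. *)
Lemma upoly_centered_moment (mu : nat -> rat) a c j : upoly 3 mu ->
  upoly (3 * (a + c + j)) (fun s => path_mean s (fun z =>
    weight s%:R z ^+ a * area rat z ^+ c.*2 * (dsize s%:R z - mu s) ^+ j)).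
Proof.
move=> Umu; elim: j a c => [|j IH] a c.
  rewrite addn0; apply: upoly_ext (upoly_path_moment a c) => s.
  by apply: eq_path_mean => z; rewrite mulr1.
have U := upoly_sub (upoly_sub (IH a.+1 c) (upoly_le _ (IH a c.+1)))
  (upoly_le _ (upoly_mul Umu (IH a c))).
apply: (upoly_ext _ (upoly_le _ (U _ _))); try lia.
move=> s; rewrite -path_meanZ -!path_meanB; apply: eq_path_mean => z.
by rewrite doubleS /dsize !exprS; ring.
Qed.

Definition path_moment8 (s : nat) : rat :=
  path_mean s (fun z => ((dsize s%:R z - path_mean s (dsize s%:R)) / 2) ^+ 8).

Lemma upoly_path_moment8 : upoly 24 path_moment8.
Proof.
have Umu : upoly 3 (fun s => path_mean s (dsize s%:R)).
  apply: upoly_ext (upoly_sub (upoly_path_moment 1 0) (upoly_path_moment 0 1)) => s.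
  by rewrite -path_meanB; apply: eq_path_mean => z; rewrite !mulr1 mul1r.
have U := upoly_mul (upoly_cst (2^-1 ^+ 8) 0) (upoly_centered_moment 0 0 8 Umu).
apply: upoly_ext U => s; rewrite -path_meanZ; apply: eq_path_mean => z.
by rewrite !mul1r exprMn mulrC.
Qed.

(** * Cores and words *)

Local Open Scope nat_scope.

(** The beta-set of a partition, listed in decreasing order; [unbeta] recovers the parts from it. *)
Definition beta (la : seq nat) : seq nat := mkseq (first_col_hook la) (size la).

Definition unbeta (h : seq nat) : seq nat :=
  mkseq (fun i => nth 0 h i - (size h - i.+1)) (size h).

Lemma size_beta la : size (beta la) = size la.
Proof. exact: size_mkseq. Qed.

Lemma betaK : cancel beta unbeta.
Proof.
move=> la; apply: (@eq_from_nth _ 0); rewrite !size_mkseq // => i ik.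
by rewrite nth_mkseq ?size_mkseq // nth_mkseq // /first_col_hook addnK.
Qed.

Lemma beta_sorted la : is_partition la -> sorted gtn (beta la).
Proof.
move=> hp; apply: (homo_sorted_in _ (allss _) (iota_ltn_sorted 0 (size la))).
move=> i j; rewrite !mem_iota => hi hj ij /=.
by have := partition_nth_le hp (ltnW ij); rewrite /first_col_hook; lia.
Qed.

Lemma beta_gt0 la : is_partition la -> 0 \notin beta la.
Proof.
move=> hp; apply/mapP => -[i]; rewrite mem_iota => hi.
by have := @partition_nth_gt0 la i hp; rewrite /first_col_hook; lia.
Qed.

Lemma sorted_gtn_nth h i j : sorted gtn h -> i < j < size h ->
  nth 0 h j + (j - i) <= nth 0 h i.
Proof.
move=> sh /andP[ij jh].
have tr : transitive gtn by move=> a b c /= ab ca; exact: ltn_trans ca ab.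
elim: j ij jh => // j IH; rewrite ltnS leq_eqVlt => /predU1P[->|ij] jh.
  by have /= := sorted_ltn_nth tr 0 sh; move=> /(_ j j.+1); rewrite !inE; lia.
have := IH ij (ltnW jh).
by have /= := sorted_ltn_nth tr 0 sh; move=> /(_ j j.+1); rewrite !inE; lia.
Qed.

Lemma sorted_gtn_nth_ge h i : sorted gtn h -> 0 \notin h -> i < size h ->
  size h - i <= nth 0 h i.
Proof.
move=> sh h0 ih; have l0 : 0 < nth 0 h (size h).-1.
  rewrite lt0n; apply: contraNN h0 => /eqP e.
  by rewrite -[X in X \in h]e mem_nth // prednK // (leq_ltn_trans _ ih).
have [e|ne] := eqVneq i (size h).-1; first by rewrite e; lia.
by have := @sorted_gtn_nth h i (size h).-1 sh; lia.
Qed.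

Lemma unbetaK h : sorted gtn h -> 0 \notin h -> beta (unbeta h) = h.
Proof.
move=> sh h0; apply: (@eq_from_nth _ 0); rewrite !size_mkseq // => i ih.
rewrite nth_mkseq ?size_mkseq // /first_col_hook nth_mkseq // size_mkseq.
by have := sorted_gtn_nth_ge sh h0 ih; lia.
Qed.

Lemma unbeta_partition h : sorted gtn h -> 0 \notin h -> is_partition (unbeta h).
Proof.
move=> sh h0; apply/andP; split.
  apply: (homo_sorted_in _ (allss _) (iota_ltn_sorted 0 (size h))).
  move=> i j; rewrite !mem_iota => hi hj ij /=.
  by have := @sorted_gtn_nth h i j sh; have := sorted_gtn_nth_ge (i := j) sh h0; lia.
apply/mapP => -[i]; rewrite mem_iota => hi.
by have := sorted_gtn_nth_ge (i := i) sh h0; lia.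
Qed.

Lemma sum_iota_double n : (\sum_(0 <= i < n) i).*2 = n * n.-1.
Proof.
by elim: n => [|n IH]; rewrite ?big_nil // big_nat_recr //= doubleD IH; nia.
Qed.

Lemma sumn_beta la : (sumn (beta la)).*2 = (sumn la).*2 + size la * (size la).-1.
Proof.
rewrite -sum_iota_double -doubleD; congr _.*2.
have sumn_mkseq f : sumn (mkseq f (size la)) = \sum_(0 <= i < size la) f i.
  by rewrite sumnE big_map /index_iota subn0.
rewrite big_nat_rev -{2}[la](mkseq_nth 0) !sumn_mkseq -big_split.
by apply: eq_bigr.
Qed.

(** With k rows and c = [conj_part la j], the difference is k - c + j - 1. It lies strictly between
    the first-column hooks of the first c rows and those of the other rows. *)
Lemma hook_length_beta la i j : is_partition la -> in_diagram la i j ->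
  hook_length la i j <= first_col_hook la i.-1 /\
  first_col_hook la i.-1 - hook_length la i j \notin beta la.
Proof.
move=> hp; rewrite /in_diagram /part => /andP[hi hj].
pose c := conj_part la j.
have cs : c <= size la by exact: count_size.
have above l : l < c -> j <= nth 0 la l.
  move=> lc; rewrite leqNgt; apply/negP => lj.
  suff : c <= l by lia.
  rewrite /c /conj_part -(cat_take_drop l la) count_cat.
  have -> : count (leq j) (drop l la) = 0.
    apply/eqP; rewrite -leqn0 leqNgt -has_count; apply/(has_nthP 0) => -[k].
    rewrite size_drop nth_drop => kl; have := @partition_nth_le la l (l + k) hp.
    lia.
  rewrite addn0; apply: leq_trans (count_size _ _) _; rewrite size_take; case: ifP; lia.
have below l : c <= l -> l < size la -> nth 0 la l < j.
  move=> cl ls; rewrite ltnNge; apply/negP => lj.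
  suff : l < c by lia.
  rewrite /c /conj_part -(cat_take_drop l.+1 la) count_cat.
  have -> : count (leq j) (take l.+1 la) = l.+1; last by lia.
  rewrite -[RHS](size_takel ls); apply/eqP; rewrite -all_count.
  apply/(all_nthP 0) => k; rewrite size_takel // => kl; rewrite nth_take //.
  by have := @partition_nth_le la k l hp; lia.
have ic : i <= c.
  rewrite leqNgt; apply/negP => ci.
  by have := below i.-1; lia.
rewrite /hook_length -/c /part /first_col_hook; split; first by lia.
apply/mapP => -[l]; rewrite mem_iota add0n => /andP[_ ls]; rewrite /first_col_hook.
case: (ltnP l c) => lc; first by have := above _ lc; lia.
by have := below _ lc ls; lia.
Qed.

(** The classical abacus criterion. The case x = d is included: it would put 0 into the beta-set, so
    d itself cannot be a first-column hook of a d-core. *)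
Lemma is_coreP d la : is_partition la -> 0 < d ->
  is_core d la <-> (forall x, x \in beta la -> d <= x -> x - d \in beta la).
Proof.
move=> hp d0; split=> [hc x /mapP[i]|H i j ij e].
  rewrite mem_iota add0n => /andP[_ ik] -> dx.
  have [j jk <-] := first_col_hook_sub hp hc d0 ik dx.
  by apply: map_f; rewrite mem_iota.
have [le nin] := hook_length_beta hp ij.
move: nin; rewrite e H //; last by rewrite -e.
by apply: map_f; rewrite mem_iota; move: ij; rewrite /in_diagram; lia.
Qed.

(** * The abacus of a good word *)

Definition suffix_sum (z : seq nat) (r : nat) := sumn (drop (size z - r) z).

Definition runner (z : seq nat) (r : nat) : nat := suffix_sum z r - r.

(** Position q t + r is level q of runner r, and the [m r] beads of a runner fill its lowest levels.
    The cut-off at t^2 loses nothing as long as [m r <= t]; the reversal gives the decreasing order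
    of [beta]. *)
Definition beads (t : nat) (m : nat -> nat) : seq nat :=
  [seq x <- rev (iota 0 (t * t)) | x %/ t < m (x %% t)].

Definition core_of_word (z : seq nat) : seq nat :=
  unbeta (beads (size z) (runner z)).

Lemma suffix_sum_cons x c r : r <= size c ->
  suffix_sum (x :: c) r = suffix_sum c r.
Proof. by move=> rc; rewrite /suffix_sum /= subSn. Qed.

Lemma suffix_sum_size z : suffix_sum z (size z) = sumn z.
Proof. by rewrite /suffix_sum subnn drop0. Qed.

Lemma suffix_sum_inj z z' : size z = size z' ->
  (forall r, r <= size z -> suffix_sum z r = suffix_sum z' r) -> z = z'.
Proof.
elim: z z' => [|x c IH] [|x' c'] //= [sc] H.
have e : c = c'.
  by apply: IH => // r rc; have := H r (leqW rc); rewrite !suffix_sum_cons -?sc.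
have := H _ (leqnn _); rewrite /suffix_sum /= sc subnn /= e.
by move=> /addIn ->.
Qed.

Lemma beads_sorted t m : sorted gtn (beads t m).
Proof.
apply: sorted_filter; first by move=> a b c /= ab ca; exact: ltn_trans ca ab.
by rewrite rev_sorted iota_ltn_sorted.
Qed.

Lemma mem_beads t m q r : (forall i, i < t -> m i <= t) -> r < t ->
  (q * t + r \in beads t m) = (q < m r).
Proof.
move=> mt rt; have t0 : 0 < t by lia.
rewrite mem_filter mem_rev mem_iota divnMDl // divn_small // addn0.
rewrite modnMDl modn_small //=; case: ltnP => //= qm.
by have := mt _ rt; nia.
Qed.

Lemma sum_runner m t r :
  (\sum_(q <- iota 0 m) (q * t + r)).*2 = m * m.-1 * t + (m * r).*2.
Proof.
rewrite big_split -big_distrl /= big_const_seq count_predT size_iota iter_addn.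
rewrite addn0 -sum_iota_double /index_iota subn0; nia.
Qed.

Lemma natr_mul_pred (V : comNzRingType) n :
  ((n * n.-1)%N%:R = n%:R * (n%:R - 1) :> V)%R.
Proof. by case: n => [|n]; rewrite ?mul0r // natrM -natr1 addrK. Qed.

Section AbacusOfWord.
Variables (s : nat) (z : seq nat).
Hypotheses (zc : z \in comps s s) (gz : good z).

Let sz : size z = s.+1.
Proof. by move: zc; rewrite mem_comps => /andP[/eqP]. Qed.

Let sm : sumn z = s.
Proof. by move: zc; rewrite mem_comps => /andP[_ /eqP]. Qed.

Lemma suffix_sum_ge r : r <= s -> r <= suffix_sum z r.
Proof.
move=> rs; have /goodP := gz => /(_ (size z - r)).
by rewrite /suffix_sum size_drop sz; lia.
Qed.

Lemma suffix_sum_mono r : suffix_sum z r <= suffix_sum z r.+1.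
Proof.
rewrite /suffix_sum; case: (ltnP r (size z)) => rz; last first.
  by rewrite (_ : size z - r.+1 = size z - r) //; lia.
rewrite (_ : size z - r = 1 + (size z - r.+1)); last by lia.
by rewrite -drop_drop; case: (drop _ z) => [|x c] //=; rewrite drop0 leq_addl.
Qed.

Lemma suffix_sum_le r : suffix_sum z r <= s.
Proof.
rewrite -[X in _ <= X]sm -[X in _ <= sumn X](cat_take_drop (size z - r) z).
by rewrite sumn_cat leq_addl.
Qed.

Lemma runner0 : runner z 0 = 0.
Proof. by rewrite /runner /suffix_sum !subn0 drop_size. Qed.

Lemma runner_last : runner z s = 0.
Proof. by have := suffix_sum_le s; rewrite /runner; lia. Qed.

Lemma runner_step r : r < s -> runner z r <= (runner z r.+1).+1.
Proof.
by move=> rs; rewrite /runner; have := suffix_sum_mono r;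
  have := suffix_sum_ge rs; lia.
Qed.

Lemma runner_le r : runner z r <= s.+1.
Proof. by have := suffix_sum_le r; rewrite /runner; lia. Qed.

Lemma mem_beads_runner q r : r < s.+1 ->
  (q * s.+1 + r \in beads s.+1 (runner z)) = (q < runner z r).
Proof. by apply: mem_beads => i _; exact: runner_le. Qed.

Lemma beads_gt0 : 0 \notin beads s.+1 (runner z).
Proof. by have := mem_beads_runner 0 (ltn0Sn s); rewrite runner0 => ->. Qed.

Lemma beta_core_of_word : beta (core_of_word z) = beads s.+1 (runner z).
Proof. by rewrite /core_of_word sz unbetaK ?beads_sorted ?beads_gt0. Qed.

(** Subtracting s + 1 lowers a bead by one level on its runner. Subtracting s moves it from (q, r)
    to (q - 1, r + 1), which is occupied by [runner_step]; runner s, where this would wrap around,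
    is empty. *)
Lemma core_of_word_cores : 0 < s -> cores s s.+1 (core_of_word z).
Proof.
move=> s0.
have hp : is_partition (core_of_word z).
  by rewrite /core_of_word sz unbeta_partition ?beads_sorted ?beads_gt0.
split=> //; split; apply/is_coreP => //; rewrite beta_core_of_word => x;
  rewrite (divn_eq x s.+1);
  move: (x %/ s.+1) (x %% s.+1) (ltn_pmod x (ltn0Sn s)) => q r rs;
  rewrite mem_beads_runner // => qm xge.
  have [rs'|rs'] := ltnP r s; last first.
    have e : r = s by lia.
    by move: qm; rewrite e runner_last.
  case: q qm xge => [|q] qm xge; first by lia.
  rewrite (_ : _ - s = q * s.+1 + r.+1); last by rewrite mulSn; lia.
  by rewrite mem_beads_runner //; have := runner_step rs'; lia.
case: q qm xge => [|q] qm xge; first by lia.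
rewrite (_ : _ - s.+1 = q * s.+1 + r); last by rewrite mulSn; lia.
by rewrite mem_beads_runner //; lia.
Qed.

Lemma perm_beads : perm_eq (beads s.+1 (runner z))
  [seq q * s.+1 + r | r <- iota 0 s.+1, q <- iota 0 (runner z r)].
Proof.
apply: uniq_perm.
- by rewrite filter_uniq // rev_uniq iota_uniq.
- apply: allpairs_uniq_dep => [|r _|]; try exact: iota_uniq.
  move=> x y /allpairsPdep[a [b [ha _ ->]]] /allpairsPdep[a' [b' [ha' _ ->]]] e.
  rewrite !mem_iota in ha ha'; rewrite /= in e.
  have ea : a = a'.
    by have := congr1 (modn^~ s.+1) e; rewrite !modnMDl !modn_small.
  by rewrite ea in e *; have -> : b = b' by nia.
- move=> x; rewrite (divn_eq x s.+1).
  move: (x %/ s.+1) (x %% s.+1) (ltn_pmod x (ltn0Sn s)) => q r rs.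
  rewrite mem_beads_runner //; apply/idP/allpairsPdep => [qm|[r' [q' [hr' hq' e]]]].
    by exists r, q; rewrite !mem_iota.
  rewrite !mem_iota in hr' hq'.
  have er : r = r' by have := congr1 (modn^~ s.+1) e; rewrite !modnMDl !modn_small.
  by rewrite er in e *; have -> : q = q' by nia.
Qed.

Local Open Scope ring_scope.

Lemma heightE r : (r <= s)%N -> height rat (drop (size z - r) z) = (runner z r)%:R.
Proof.
move=> rs; rewrite /height size_drop subKn; last by rewrite sz; lia.
by rewrite /runner natrB ?suffix_sum_ge.
Qed.

Lemma sum_suffixes (V : nmodType) (F : nat -> seq nat -> V) (G : seq nat -> V) :
  G [::] = 0 -> (forall x c, G (x :: c) = G c + F (size c) c) ->
  forall y, G y = \sum_(0 <= r < size y) F r (drop (size y - r) y).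
Proof.
move=> G0 GS; elim=> [|x c IH]; first by rewrite big_nil.
rewrite GS IH big_nat_recr // subSnn /= drop0; congr (_ + _).
by apply: eq_big_nat => r /andP[_ rc]; rewrite subSn 1?ltnW.
Qed.

Lemma dsizeE : dsize (s%:R : rat) z =
  \sum_(0 <= r < s.+1) wt s%:R r (runner z r)%:R -
  (\sum_(0 <= r < s.+1) (runner z r)%:R) ^+ 2.
Proof.
rewrite /dsize; congr (_ - _ ^+ 2).
  pose F r c := wt s%:R r (height rat c).
  rewrite (sum_suffixes (F := F) (G := weight s%:R)) // sz.
  by apply: eq_big_nat => r /andP[_ rs]; rewrite /F -sz heightE.
rewrite (sum_suffixes (F := fun r c => height rat c) (G := area rat)) //.
by rewrite sz; apply: eq_big_nat => r /andP[_ rs]; rewrite -sz heightE.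
Qed.

(** The number of parts is the number B of beads, and twice the sum of the bead positions is A - B.
    Hence twice the size is A - B - B (B - 1) = A - B^2. *)
Lemma partition_size_core_of_word :
  partition_size (core_of_word z) = dsize s%:R z / 2.
Proof.
set la := core_of_word z.
have ek : size la = (\sum_(0 <= r < s.+1) runner z r)%N.
  rewrite -size_beta beta_core_of_word (perm_size perm_beads) size_allpairs_dep.
  by rewrite sumnE big_map /index_iota subn0; apply: eq_bigr => r _; rewrite size_iota.
have eh : (sumn (beta la)).*2%:R = \sum_(0 <= r < s.+1)
    (wt s%:R r (runner z r)%:R - (runner z r)%:R) :> rat.
  rewrite beta_core_of_word sumnE (perm_big _ perm_beads) big_allpairs_dep.
  rewrite -muln2 natrM natr_sum mulr_suml /index_iota subn0; apply: eq_bigr => r _.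
  rewrite -natrM muln2 sum_runner -muln2 natrD natrM natr_mul_pred !natrM -natr1 /wt.
  ring.
have := sumn_beta la => /(congr1 (fun n => n%:R : rat)).
rewrite eh natrD natr_mul_pred ek natr_sum sumrB -muln2 natrM => e.
have two0 : (2 : rat) != 0 by [].
rewrite /partition_size dsizeE; apply: (canRL (mulfK two0)); move: e.
set b := \sum_(_ <= _ < _) (runner z _)%:R => e.
by apply: (addIr (b * (b - 1))); rewrite -e; ring.
Qed.

End AbacusOfWord.

Local Open Scope nat_scope.

Lemma core_of_word_inj s : {in [pred z | (z \in comps s s) && good z] &,
  injective core_of_word}.
Proof.
move=> z z' /andP[zc gz] /andP[zc' gz'] /(congr1 beta).
rewrite (beta_core_of_word zc gz) (beta_core_of_word zc' gz') => e.
have [sz sm] : size z = s.+1 /\ sumn z = s.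
  by move: zc; rewrite mem_comps => /andP[/eqP -> /eqP ->].
have [sz' sm'] : size z' = s.+1 /\ sumn z' = s.
  by move: zc'; rewrite mem_comps => /andP[/eqP -> /eqP ->].
apply: suffix_sum_inj; first by rewrite sz sz'.
move=> r; rewrite sz leq_eqVlt => /predU1P[->|rs].
  by rewrite -{1}sz -sz' !suffix_sum_size sm sm'.
have := suffix_sum_ge zc gz (r := r) rs; have := suffix_sum_ge zc' gz' (r := r) rs.
suff : runner z r = runner z' r by rewrite /runner; lia.
have E q : (q < runner z r) = (q < runner z' r).
  by rewrite -(mem_beads_runner zc) // -(mem_beads_runner zc') // e.
have [lt|gt|//] := ltngtP (runner z r) (runner z' r).
  by have := E (runner z r); rewrite ltnn lt.
by have := E (runner z' r); rewrite ltnn gt.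
Qed.

(** * From a core back to its word *)

Fixpoint word_of (m : nat -> nat) (r : nat) : seq nat :=
  if r is r'.+1 then ((m r).+1 - m r') :: word_of m r' else [::].

Section WordOfCore.
Variables (s : nat) (m : nat -> nat).
Hypotheses (m0 : m 0 = 0) (ms : m s = 0)
  (m_step : forall r, r < s -> m r <= (m r.+1).+1).

Lemma size_word_of r : size (word_of m r) = r.
Proof. by elim: r => //= r ->. Qed.

Lemma sumn_word_of r : r <= s -> sumn (word_of m r) = m r + r.
Proof.
elim: r => [|r IH] rs /=; first by rewrite m0.
by rewrite IH 1?ltnW //; have := m_step rs; lia.
Qed.

(** The first s letters already have sum m_s + s = s, so the last letter, at the head of the list,
    must be 0. *)
Lemma word_of_comps : 0 :: word_of m s \in comps s s.
Proof. by rewrite mem_comps /= size_word_of sumn_word_of // ms !eqxx. Qed.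

Lemma good_word_of : good (0 :: word_of m s).
Proof.
suff H r x : r <= s -> good (x :: word_of m r) by exact: H.
elim: r x => [|r IH] x rs //; apply/andP; split.
  by rewrite size_word_of sumn_word_of // leq_addl.
exact: IH (ltnW rs).
Qed.

Lemma runner_word_of r : r <= s -> runner (0 :: word_of m s) r = m r.
Proof.
move=> rs; rewrite /runner suffix_sum_cons ?size_word_of //.
suff -> : suffix_sum (word_of m s) r = sumn (word_of m r).
  by rewrite sumn_word_of // addnK.
elim: s rs => [|n IH]; first by rewrite leqn0 => /eqP->.
rewrite leq_eqVlt => /predU1P[->|rn].
  by rewrite -{2}(size_word_of n.+1) suffix_sum_size.
by rewrite /= suffix_sum_cons ?size_word_of // IH.
Qed.
End WordOfCore.

Lemma core_of_word_surj s la : 0 < s -> cores s s.+1 la ->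
  exists2 z, (z \in comps s s) && good z & la = core_of_word z.
Proof.
move=> s0 [hp [hs ht]].
have ds := (is_coreP hp s0).1 hs; have dt := (is_coreP hp (ltn0Sn s)).1 ht.
have b0 := beta_gt0 hp.
have bd x : x \in beta la -> x < s * s.+1.
  move=> /mapP[i]; rewrite mem_iota add0n => /andP[_ ik] ->.
  exact: first_col_hook_bound.
(* The lowest gap on runner r. It is found among the levels 0, ..., s because all first-column hooks
   are below s (s + 1), so that level s is empty. *)
pose m r := find (fun q => q * s.+1 + r \notin beta la) (iota 0 s.+1).
have mP q r : r < s.+1 -> (q * s.+1 + r \in beta la) = (q < m r).
  move=> rs.
  have hasm : has (fun q => q * s.+1 + r \notin beta la) (iota 0 s.+1).
    apply/hasP; exists s; first by rewrite mem_iota /=.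
    by apply/negP => /bd; lia.
  have ms : m r < s.+1 by move: hasm; rewrite has_find size_iota.
  case: ltnP => qm.
    by have := before_find 0 qm; rewrite nth_iota ?add0n => [/negbFE|]; lia.
  (* Closure under subtraction of s + 1 would bring any bead above the gap down into it. *)
  apply/negbTE; rewrite -(subnK qm); elim: (q - m r) => [|k IH].
    by have := nth_find 0 hasm; rewrite nth_iota.
  apply: contraNN IH => /dt; rewrite addSn mulSn => /(_ _).
  by rewrite -addnA addKn; apply; exact: leq_addr.
have m0 : m 0 = 0.
  by apply/eqP; rewrite -leqn0 leqNgt -mP.
have ms : m s = 0.
  apply/eqP; rewrite -leqn0 leqNgt -mP //; apply/negP => /ds.
  by rewrite mul0n add0n subnn (negbTE b0) => /(_ (leqnn s)).
have m_step r : r < s -> m r <= (m r.+1).+1.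
  move=> rs; rewrite leqNgt -mP; last by lia.
  apply/negP => /ds.
  rewrite (_ : _ - s = m r.+1 * s.+1 + r.+1); last by rewrite mulSn; lia.
  by rewrite mP // ltnn mulSn => /(_ _) H; have := H; lia.
have zc := word_of_comps m0 ms m_step; have gz := good_word_of m0 ms m_step.
exists (0 :: word_of m s); first by rewrite zc gz.
rewrite -[LHS]betaK -[RHS]betaK; congr unbeta.
rewrite (beta_core_of_word zc gz).
apply: (irr_sorted_eq (leT := gtn)).
- by move=> a b c /= ab ca; exact: ltn_trans ca ab.
- by move=> a /=; rewrite ltnn.
- exact: beta_sorted.
- exact: beads_sorted.
move=> x; rewrite (divn_eq x s.+1).
move: (x %/ s.+1) (x %% s.+1) (ltn_pmod x (ltn0Sn s)) => q r rs.
by rewrite mP // (mem_beads_runner zc) // runner_word_of.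
Qed.

Local Open Scope ring_scope.

(** * Averages over cores as averages over good words *)

Lemma perm_cores s : (0 < s)%N -> perm_eq (fset_set (cores s s.+1))
  [seq core_of_word z | z <- [seq z <- comps s s | good z]].
Proof.
move=> s0; apply: uniq_perm; first exact: fset_uniq.
  rewrite map_inj_in_uniq ?filter_uniq ?uniq_comps // => z z'.
  rewrite !mem_filter => /andP[gz zc] /andP[gz' zc'].
  by apply: (@core_of_word_inj s); rewrite inE ?gz ?gz' ?zc ?zc'.
move=> la; rewrite in_fset_set; last exact: finite_cores.
apply/idP/mapP => [|[z]].
  rewrite inE => /(core_of_word_surj s0)[z /andP[zc gz] ->].
  by exists z; rewrite // mem_filter gz.
by rewrite mem_filter => /andP[gz zc] ->; rewrite inE; exact: core_of_word_cores.
Qed.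

Lemma uniform_expectation_cores s (F : rat -> rat) : (0 < s)%N ->
  uniform_expectation (cores s s.+1) (fun la => F (partition_size la)) =
  (\sum_(z <- comps s s | good z) F (dsize s%:R z / 2)) /
  (\sum_(z <- comps s s | good z) 1).
Proof.
move=> s0; rewrite /uniform_expectation (perm_big _ (perm_cores s0)) /=.
rewrite big_map big_filter big_seq_cond [in RHS]big_seq_cond; congr (_ / _).
  by apply: eq_bigr => z /andP[zc gz]; rewrite (partition_size_core_of_word zc gz).
by rewrite (perm_size (perm_cores s0)) size_map size_filter -sum1_count natr_sum.
Qed.

Local Open Scope ring_scope.

(** * Joint moments by dynamic programming *)

Fixpoint zipw (S T U : Type) (f : S -> T -> U) (l : seq S) (l' : seq T) :=
  if l is x :: l1 then if l' is y :: l2 then f x y :: zipw f l1 l2 else [::]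
  else [::].

Fixpoint unroll (T : Type) (step : seq T -> seq T) (k : nat) (l : seq T) :=
  if k is k'.+1 then
    if l is x :: _ then x :: unroll step k' (step l) else [::]
  else [::].

Lemma zipw_mkseq (S T U : Type) (f : S -> T -> U) g h m n :
  zipw f (mkseq g m) (mkseq h n) = mkseq (fun i => f (g i) (h i)) (minn m n).
Proof.
suff H i0 : zipw f [seq g i | i <- iota i0 m] [seq h i | i <- iota i0 n] =
    [seq f (g i) (h i) | i <- iota i0 (minn m n)] by exact: H.
elim: m n i0 => [|m IH] [|n] i0; rewrite ?minn0 ?min0n // minnSS /=.
by rewrite IH.
Qed.

Lemma behead_mkseq (T : Type) (g : nat -> T) n :
  behead (mkseq g n) = mkseq (fun i => g i.+1) n.-1.
Proof. by case: n => //= n; rewrite /mkseq /= (iotaDl 1 0) -map_comp. Qed.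

Lemma mkseqS_cons (T : Type) (g : nat -> T) n :
  mkseq g n.+1 = g 0%N :: mkseq (fun i => g i.+1) n.
Proof. by rewrite /mkseq /= (iotaDl 1 0) -map_comp. Qed.

Lemma eq_mkseq_lt (T : Type) (g h : nat -> T) n :
  (forall i, (i < n)%N -> g i = h i) -> mkseq g n = mkseq h n.
Proof.
by move=> e; apply/eq_in_map => i; rewrite mem_iota add0n => /andP[_ /e].
Qed.

Section Tables.
Variable R : comNzRingType.

Definition addt : seq (seq R) -> seq (seq R) -> seq (seq R) :=
  zipw (zipw +%R).

Definition row_step (m : R) (l : seq R) :=
  zipw (fun x y => y + m * x) l (behead l).

Definition tbl_step (v : R) (t : seq (seq R)) :=
  zipw (zipw (fun x y => y + v * x)) t (behead t).

(** Replaces A by A + v and B by B + m without binomial coefficients: each step multiplies the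
    integrand by A + v or by B + m and shortens the list by one, and [unroll] collects the heads. *)
Definition translate (v m : R) (t : seq (seq R)) :=
  [seq unroll (row_step m) (size r) r
  | r <- unroll (tbl_step v) (size t) t].

(* On tables of moments of (A, B) this multiplies the integrand by
   [c * (A - B ^+ 2) - y]. *)
Definition mul_centered (c y : R) (t : seq (seq R)) :=
  zipw (fun r r' => zipw (fun x x' => c * x' - y * x) r
                      (zipw (fun u w => w - u) (behead (behead r)) r'))
       t (behead t).

(** The triangle 2 a + b <= 2 k. Multiplying the integrand by A or B^2 consumes one unit of k. *)
Definition tbl (F : nat -> nat -> R) (k : nat) :=
  mkseq (fun a => mkseq (F a) ((k - a).*2.+1)) k.+1.

Lemma eq_tbl F G k : F =2 G -> tbl F k = tbl G k.
Proof. by move=> e; apply: eq_mkseq => a; apply: eq_mkseq => b; exact: e. Qed.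

Lemma addt_tbl F G k : addt (tbl F k) (tbl G k) = tbl (fun a b => F a b + G a b) k.
Proof.
rewrite /addt /tbl zipw_mkseq minnn; apply: eq_mkseq => a.
by rewrite zipw_mkseq minnn.
Qed.

Section Moments.
Variables (T : Type) (cs : seq T) (p : pred T) (A B : T -> R).

Definition moment (g : T -> R) a b :=
  \sum_(z <- cs | p z) g z * A z ^+ a * B z ^+ b.

Lemma row_unroll (g : T -> R) m k :
  unroll (row_step m) k (mkseq (fun b => \sum_(z <- cs | p z) g z * B z ^+ b) k) =
  mkseq (fun b => \sum_(z <- cs | p z) g z * (B z + m) ^+ b) k.
Proof.
elim: k g => [//|k IH] g.
have E : row_step m (mkseq (fun b => \sum_(z <- cs | p z) g z * B z ^+ b) k.+1)
   = mkseq (fun b => \sum_(z <- cs | p z) (g z * (B z + m)) * B z ^+ b) k.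
  rewrite /row_step behead_mkseq zipw_mkseq (minn_idPr (leqnSn k)) /=.
  apply: eq_mkseq => b; rewrite mulr_sumr -big_split /=.
  by apply: eq_bigr => z _; rewrite exprS; ring.
set t := mkseq _ k.+1 in E *.
have -> : unroll (row_step m) k.+1 t =
  head 0 t :: unroll (row_step m) k (row_step m t) by [].
rewrite E (IH (fun z => g z * (B z + m))) [RHS]mkseqS_cons; congr (_ :: _).
by apply: eq_mkseq => b; apply: eq_bigr => z _; rewrite exprS mulrA.
Qed.

Lemma tbl_unroll (g : T -> R) v k :
  unroll (tbl_step v) k.+1 (tbl (moment g) k) =
  tbl (fun a b => \sum_(z <- cs | p z) g z * (A z + v) ^+ a * B z ^+ b) k.
Proof.
elim: k g => [|k IH] g.
  by rewrite /tbl /mkseq /= /moment; do 2 congr (_ :: _); apply: eq_bigr.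
have E : tbl_step v (tbl (moment g) k.+1)
   = tbl (moment (fun z => g z * (A z + v))) k.
  rewrite /tbl_step {1 2}/tbl behead_mkseq zipw_mkseq -pred_Sn (minn_idPr (leqnSn _)).
  apply: eq_mkseq => a; rewrite subSS zipw_mkseq.
  rewrite (_ : minn _ _ = (k - a).*2.+1); last by lia.
  apply: eq_mkseq => b; rewrite /moment mulr_sumr -big_split /=.
  by apply: eq_bigr => z _; rewrite exprS; ring.
set X := unroll _ _ _; set Y := tbl _ _.
have -> : X = head [::] (tbl (moment g) k.+1) ::
  unroll (tbl_step v) k.+1 (tbl_step v (tbl (moment g) k.+1)) by [].
rewrite E IH {}/X {}/Y /tbl [in RHS]mkseqS_cons mkseqS_cons /=; congr (_ :: _).
apply: eq_mkseq => a; rewrite subSS; apply: eq_mkseq => b.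
by apply: eq_bigr => z _; rewrite exprS mulrA.
Qed.

Lemma translate_tbl v m k :
  translate v m (tbl (moment (fun=> 1)) k) =
  tbl (fun a b => \sum_(z <- cs | p z) (A z + v) ^+ a * (B z + m) ^+ b) k.
Proof.
rewrite /translate {1}size_mkseq tbl_unroll -[LHS]map_comp.
apply: eq_map => a; rewrite [LHS]/comp size_mkseq.
rewrite -[RHS]row_unroll; congr unroll; apply: eq_mkseq => b.
by apply: eq_bigr => z _; rewrite mul1r.
Qed.

Lemma mul_centered_tbl (g : T -> R) c y k :
  mul_centered c y (tbl (moment g) k.+1) =
  tbl (moment (fun z => g z * (c * (A z - B z ^+ 2) - y))) k.
Proof.
rewrite /mul_centered {1 2}/tbl behead_mkseq zipw_mkseq -pred_Sn (minn_idPr (leqnSn _)).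
apply: eq_mkseq_lt => a ak; rewrite !behead_mkseq !zipw_mkseq subSS.
rewrite (_ : minn (_ - a).*2.+1 _ = (k - a).*2.+1); last by lia.
apply: eq_mkseq => b; rewrite /moment -sumrB !mulr_sumr -sumrB.
by apply: eq_bigr => z _; rewrite !exprS expr0; ring.
Qed.

Lemma iter_mul_centered_tbl (g : T -> R) c y k j :
  iter j (mul_centered c y) (tbl (moment g) (j + k)) =
  tbl (moment (fun z => g z * (c * (A z - B z ^+ 2) - y) ^+ j)) k.
Proof.
elim: j k => [|j IH] k.
  by apply: eq_tbl => a b; apply: eq_bigr => z _; rewrite expr0 mulr1.
rewrite iterS addSnnS IH mul_centered_tbl; apply: eq_tbl => a b.
by apply: eq_bigr => z _; rewrite (exprSr _ j) !mulrA.
Qed.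

End Moments.

Section DynamicProgramming.
Variables (force : seq (seq R) -> bool) (s : R) (deg : nat).

(* The branches are equal: the test makes lazy reduction evaluate [t]. *)
Definition strict (U : Type) (t : seq (seq R)) (k : seq (seq R) -> U) : U :=
  if force t then k t else k t.

(** Row n is computed from row n - 1, starting at the diagonal T = n. There are no good words for T
    < n, so the first [prev] is the zero table. *)
Fixpoint next_row (n T : nat) (prev : seq (seq R)) (row : seq (seq (seq R))) :=
  if row is t :: row' then
    let m := T%:R - n%:R in
    strict (addt prev (translate (wt s n m) m t))
      (fun x => x :: next_row n T.+1 x row')
  else [::].

(** Each row is one entry shorter than the preceding one, so after k steps only the entry on the
    diagonal is left. Testing [size row'] has the row evaluated before the next one is begun. *)
Fixpoint rows (n k : nat) (row : seq (seq (seq R))) :=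
  if k is k'.+1 then
    let row' := next_row n n (tbl (fun _ _ => 0) deg) (behead row) in
    if size row' == 0%N then row' else rows n.+1 k' row'
  else row.

Definition good_moments (k : nat) :=
  head [::] (rows 1 k
    (mkseq (fun=> tbl (fun a b => 0 ^+ a * 0 ^+ b) deg) k.+1)).

Definition cell n T :=
  tbl (moment (comps n T) good (weight s) (@area R) (fun=> 1)) deg.

Lemma cell_diag n : cell n.+1 n = tbl (fun _ _ => 0) deg.
Proof.
apply: eq_tbl => a b; rewrite /moment big_seq_cond big1 // => -[|x c].
  by rewrite mem_comps.
by rewrite mem_comps /= => /and3P[/andP[]]; lia.
Qed.

Lemma cellS n T : (n <= T)%N ->
  let m := T.+1%:R - n.+1%:R in
  cell n.+1 T.+1 = addt (cell n.+1 T) (translate (wt s n.+1 m) m (cell n T.+1)).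
Proof.
move=> nT /=; rewrite /cell translate_tbl addt_tbl; apply: eq_tbl => a b.
rewrite /moment big_comps; congr (_ + _).
  under eq_bigl do rewrite good_bump.
  by under eq_bigr do rewrite weight_bump area_bump.
rewrite big_seq_cond [RHS]big_seq_cond; apply: eq_big => [c|c].
  rewrite /= mem_comps; case: eqP => //= ->; case: eqP => //= ->.
  by rewrite ltnS nT.
by rewrite mem_comps => /andP[/andP[/eqP sz /eqP sm] _] /=; rewrite /height sz sm mul1r.
Qed.

Lemma next_rowE n i k : 
  next_row n.+1 (n.+1 + i)%N (cell n.+1 (n + i))
    (mkseq (fun j => cell n (n.+1 + i + j)) k) =
  mkseq (fun j => cell n.+1 (n.+1 + i + j)) k.
Proof.
elim: k i => [|k IH] i //.
rewrite !mkseqS_cons addn0 /= /strict if_same addSn -cellS ?leq_addr //.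
have e p : mkseq (fun j => cell p (n.+1 + i + j.+1)) k =
    mkseq (fun j => cell p (n.+1 + i.+1 + j)) k.
  by apply: eq_mkseq => j; congr cell; lia.
by rewrite !e -IH -!addnS addSnnS.
Qed.

Lemma rowsE n k : 
  rows n.+1 k (mkseq (fun j => cell n (n + j)) k.+1) = [:: cell (n + k) (n + k)].
Proof.
elim: k n => [|k IH] n; first by rewrite /mkseq /= addn0.
have E : next_row n.+1 n.+1 (tbl (fun _ _ => 0) deg)
   (behead (mkseq (fun j => cell n (n + j)) k.+2)) =
   mkseq (fun j => cell n.+1 (n.+1 + j)) k.+1.
  have := next_rowE n 0 k.+1; rewrite !addn0 cell_diag behead_mkseq => <-.
  by congr next_row; apply: eq_mkseq => j; rewrite addnS.
rewrite -[LHS]/(let row' := next_row n.+1 n.+1 _ _ in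
  if size row' == 0%N then row' else rows n.+2 k row') E.
by cbv zeta; rewrite size_mkseq IH addSnnS.
Qed.

Lemma good_momentsE k : good_moments k = cell k k.
Proof.
rewrite /good_moments -[RHS]/(head [::] [:: cell k k]) -[k in cell k k]add0n.
rewrite -rowsE; congr (head _ (rows _ _ _)); apply: eq_mkseq => T.
apply: eq_tbl => a b; rewrite /moment /= big_cons big_nil addr0 mul1r.
by rewrite /= /wt /height /= subrr !mul0r !addr0.
Qed.

End DynamicProgramming.

End Tables.

(** Visits every binary digit, so that deciding the test in [strict] evaluates the integers
    completely. *)
Fixpoint force_pos (p : positive) : bool :=
  match p with xH => true | xO p | xI p => force_pos p end.

Definition forceZ : seq (seq Z) -> bool :=
  all (all (fun z =>
    match z with Z0 => true | Zpos p | Zneg p => force_pos p end)).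

(** * The eighth moment *)

Section StatisticsMorphism.
Variables (R S : comNzRingType) (f : {rmorphism R -> S}).

Lemma rmorph_height c : f (height R c) = height S c.
Proof. by rewrite /height rmorphB !rmorph_nat. Qed.

Lemma rmorph_area z : f (area R z) = area S z.
Proof. by elim: z => [|x c IH] /=; rewrite ?rmorph0 // rmorphD IH rmorph_height. Qed.

Lemma rmorph_weight s z : f (weight s z) = weight (f s) z.
Proof.
elim: z => [|x c IH] /=; first by rewrite rmorph0.
rewrite rmorphD IH -rmorph_height /wt; move: (height R c) => h.
by rewrite rmorphM rmorphD rmorphM rmorphD rmorph1 rmorphB rmorphM !rmorph_nat.
Qed.

Lemma rmorph_dsize s z : f (dsize s z) = dsize (f s) z.
Proof. by rewrite /dsize rmorphB rmorphXn rmorph_weight rmorph_area. Qed.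
End StatisticsMorphism.

Definition ratZ : {rmorphism Z -> rat} := (intr \o int_of_Z)%FUN.

(* Decimal numerals are kept as such: the unary numbers denoted by
   [Nat.of_num_uint] are too large to be evaluated. *)
Delimit Scope dec_uint_scope with uint.

Definition Zdigit (i : nat) (acc : Z) : Z :=
  Z.add (Z.of_nat i) (Z.mul (Z.of_nat 10) acc).

Fixpoint Zdec (d : Decimal.uint) (acc : Z) : Z :=
  match d with
  | Decimal.Nil => acc
  | Decimal.D0 d => Zdec d (Zdigit 0 acc)
  | Decimal.D1 d => Zdec d (Zdigit 1 acc)
  | Decimal.D2 d => Zdec d (Zdigit 2 acc)
  | Decimal.D3 d => Zdec d (Zdigit 3 acc)
  | Decimal.D4 d => Zdec d (Zdigit 4 acc)
  | Decimal.D5 d => Zdec d (Zdigit 5 acc)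
  | Decimal.D6 d => Zdec d (Zdigit 6 acc)
  | Decimal.D7 d => Zdec d (Zdigit 7 acc)
  | Decimal.D8 d => Zdec d (Zdigit 8 acc)
  | Decimal.D9 d => Zdec d (Zdigit 9 acc)
  end.

Lemma Zdec_of_uint d acc : Zdec d (Z.of_nat acc) = Z.of_nat (Nat.of_uint_acc d acc).
Proof.
by elim: d acc => [|d IH|d IH|d IH|d IH|d IH|d IH|d IH|d IH|d IH|d IH] acc //;
  rewrite [LHS]/= [RHS]/= -IH Nat.tail_mul_spec; congr Zdec;
  rewrite /Zdigit; lia.
Qed.

Definition Zlit (d : Number.uint) : Z :=
  match d with
  | Number.UIntDecimal d => Zdec d 0
  | Number.UIntHexadecimal d => Z.of_nat (Nat.of_hex_uint d)
  end.

(** The reading of large numerals that agrees with the statement of the theorem; [Zlit] is its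
    binary counterpart, used for computing. *)
Definition ratlit (d : Number.uint) : rat := (Nat.of_num_uint d)%:R.

Lemma ratZ_lit d : ratZ (Zlit d) = ratlit d.
Proof.
have -> : Zlit d = Z.of_nat (Nat.of_num_uint d).
  by case: d => d //; exact: (Zdec_of_uint d 0).
by rewrite /ratlit -(rmorph_nat ratZ); congr (ratZ _); lia.
Qed.

(** The reading [lit] of the numerals is a parameter, so that one expression serves both the integer
    test and the rational formula. *)
Definition numerator8 (R : comNzRingType) (lit : Number.uint -> R) (x : R) : R :=
  x ^+ 2 * (x - 1) * (2 * x + 1) * (x + 1) ^+ 2 *
  (lit 308851624%uint * x ^+ 18 - lit 2759073420%uint * x ^+ 17
    + lit 7345195650%uint * x ^+ 16 + lit 1614779679%uint * x ^+ 15
    - lit 27716691813%uint * x ^+ 14 - lit 3203324556%uint * x ^+ 13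
    + lit 61922226136%uint * x ^+ 12 + lit 52270343442%uint * x ^+ 11
    - lit 49025878614%uint * x ^+ 10 - lit 146716496688%uint * x ^+ 9
    - lit 153171599682%uint * x ^+ 8 - lit 30342055161%uint * x ^+ 7
    + lit 158893451131%uint * x ^+ 6 - lit 165853921776%uint * x ^+ 5
    + lit 1073038790016%uint * x ^+ 4 + lit 9260929255680%uint * x ^+ 3
    - lit 11293714925568%uint * x ^+ 2 - lit 19188060088320%uint * x
    + lit 21924617379840%uint).

Definition formula8 (s : nat) : rat :=
  (ratlit 914624815104000%uint)^-1 * numerator8 ratlit s%:R.

Lemma upoly_formula8 : upoly 24 formula8.
Proof.
have M c i : (i <= 18)%N -> upoly 18 (fun s => c * s%:R ^+ i).
  move=> i18; apply: upoly_le (upoly_mul (upoly_cst c 0) (upoly_exp i upoly_id)).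
  by lia.
have M1 c : upoly 18 (fun s => c * s%:R) by exact: (M c 1%N).
rewrite /formula8 /numerator8; move: ratlit => lit.
apply: (upoly_mul (upoly_cst _ 0) (d' := 24)).
apply: (upoly_mul (d := 6) (d' := 18)); last first.
  by repeat first [apply: upoly_cst | by apply: M | apply: M1
                  | apply: upoly_sub | apply: upoly_add].
apply: (upoly_mul (d := 4) (d' := 2)); last first.
  apply: (upoly_exp 2 (upoly_add upoly_id (upoly_cst 1 1))).
apply: (upoly_mul (d := 3) (d' := 1)); last first.
  apply: upoly_add (upoly_cst 1 1).
  exact: upoly_mul (upoly_cst 2 0) upoly_id.
apply: (upoly_mul (d := 2) (d' := 1)); first exact: (upoly_exp 2 upoly_id).
exact: upoly_sub upoly_id (upoly_cst 1 1).
Qed.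

Definition head2 (R : comNzRingType) (t : seq (seq R)) : R := head 0 (head [::] t).

(** [c] is the number of good words and [y] the sum of their [dsize]. Clearing denominators in the
    mean of ((d - y / c) / 2)^8 gives the factor 2^8 c^9 and keeps the test in the integers. *)
Definition check8 (s : nat) : bool :=
  let t : seq (seq Z) := good_moments forceZ (Z.of_nat s) 8 s in
  let c := head2 t in
  let y := head2 (mul_centered 1 0 t) in
  (c != 0) && (Zlit 914624815104000%uint * head2 (iter 8 (mul_centered c y) t)
               == 256 * c ^+ 9 * numerator8 Zlit (Z.of_nat s)).

(** The 25 values s = 0, ..., 24 determine a polynomial of degree at most 24. *)
Lemma check8_le24 : all check8 (iota 0 25).
Proof. by vm_cast_no_check (erefl true). Qed.

Lemma rmorph_numerator8 (R S : comNzRingType) (f : {rmorphism R -> S}) lit x :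
  f (numerator8 lit x) = numerator8 (f \o lit) (f x).
Proof.
by rewrite /numerator8 !(rmorphXn, rmorphM, rmorphD, rmorphN, rmorph1).
Qed.

Lemma path_mean_good s (F : rat -> rat) :
  path_mean s (fun z => F (dsize s%:R z)) =
  (\sum_(z <- comps s s | good z) F (dsize s%:R z)) /
  (\sum_(z <- comps s s | good z) 1).
Proof.
have s0 : s.+1%:R != 0 :> rat by rewrite pnatr_eq0.
have -> : path_mean s (fun z => F (dsize s%:R z)) =
    (\sum_(z <- comps s s) F (dsize s%:R z)) / (\sum_(z <- comps s s) 1).
  by rewrite /path_mean -sum1_size natr_sum.
rewrite !(sum_comps_good s) (sum_comps_good s (fun=> 1)).
by rewrite invfM mulrACA divff // mul1r.
Qed.

Lemma central_moment_cores s : (0 < s)%N ->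
  central_moment (cores s s.+1) partition_size 8 = path_moment8 s.
Proof.
move=> s0; rewrite /central_moment.
rewrite (uniform_expectation_cores (fun x => (x - _) ^+ 8) s0).
rewrite (uniform_expectation_cores id s0) /path_moment8.
rewrite (path_mean_good s (fun y => ((y - _) / 2) ^+ 8)) (path_mean_good s id).
congr (_ / _); apply: eq_bigr => z _; congr (_ ^+ 8).
by rewrite -mulr_suml; ring.
Qed.

Lemma ratZ_eq0 z : (ratZ z == 0) = (z == 0).
Proof. by rewrite /= intr_eq0 -(rmorph0 int_of_Z) (can_eq int_of_ZK). Qed.

Lemma expr8_centered (c d y : rat) : c != 0 ->
  ((d - y / c) / 2) ^+ 8 / c = (c * d - y) ^+ 8 / (256 * c ^+ 9).
Proof.
move=> c0; have -> : (d - y / c) / 2 = (c * d - y) / (2 * c) by field.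
by rewrite expr_div_n -mulrA -invfM; congr (_ / _); ring.
Qed.

Lemma path_moment8_of_check s (k n : Z) (kr nr : rat) :
  ratZ k = kr -> ratZ n = nr -> kr != 0 ->
  (let t : seq (seq Z) := good_moments forceZ (Z.of_nat s) 8 s in
   let c := head2 t in
   let y := head2 (mul_centered 1 0 t) in
   (c != 0) && (k * head2 (iter 8 (mul_centered c y) t) == 256 * c ^+ 9 * n)) ->
  path_moment8 s = kr^-1 * nr.
Proof.
move=> kE nE k0; rewrite good_momentsE; set t := cell _ _ _ _.
(* Eight multiplications by the centered size use up all eight levels of the table and leave the
   single entry (0, 0). *)
have tE : t = tbl (moment (comps s s) good (weight (Z.of_nat s)) (@area Z) (fun=> 1))
  (8 + 0) by [].
have headE F d : head2 (tbl F d) = F 0%N 0%N :> Z by [].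
have momE g : moment (comps s s) good (weight (Z.of_nat s)) (@area Z) g 0%N 0%N =
    \sum_(z <- comps s s | good z) g z.
  by apply: eq_bigr => z _; rewrite !mulr1.
cbv zeta; move Ec : (head2 t) => c; move Ey : (head2 (mul_centered 1 0 t)) => y.
have cE : c = \sum_(z <- comps s s | good z) 1 by rewrite -Ec tE headE momE.
have yE : y = \sum_(z <- comps s s | good z) dsize (Z.of_nat s) z.
  rewrite -Ey tE (mul_centered_tbl _ _ _ _ (fun=> 1)) headE momE.
  by apply: eq_bigr => z _; rewrite !mul1r subr0.
rewrite tE iter_mul_centered_tbl headE momE => /andP[c0 /eqP E].
have Zs : ratZ (Z.of_nat s) = s%:R.
  by rewrite -(rmorph_nat ratZ); congr (ratZ _); lia.
have ratd z : ratZ (dsize (Z.of_nat s) z) = dsize s%:R z by rewrite rmorph_dsize Zs.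
pose C : rat := \sum_(z <- comps s s | good z) 1.
pose Y : rat := \sum_(z <- comps s s | good z) dsize s%:R z.
have ratc : ratZ c = C by rewrite cE rmorph_sum; apply: eq_bigr => z _; rewrite rmorph1.
have raty : ratZ y = Y by rewrite yE rmorph_sum; apply: eq_bigr => z _; exact: ratd.
have C0 : C != 0 by rewrite -ratc ratZ_eq0.
have {}E : kr *
    (\sum_(z <- comps s s | good z) (C * dsize s%:R z - Y) ^+ 8) =
    256 * C ^+ 9 * nr.
  have := congr1 ratZ E; rewrite (rmorphM ratZ k) (rmorphM ratZ _ n).
  rewrite (rmorphM ratZ 256) (rmorphXn ratZ) (rmorph_nat ratZ 256) rmorph_sum.
  rewrite kE nE ratc => <-; congr (_ * _); apply: eq_bigr => z _.
  by rewrite mul1r rmorphXn rmorphB rmorphM ratd ratc raty.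
rewrite /path_moment8 (path_mean_good s (fun y => ((y - _) / 2) ^+ 8)).
rewrite (path_mean_good s id) -/C -/Y.
rewrite [LHS]mulr_suml; rewrite (eq_bigr _ (fun z _ => expr8_centered _ _ C0)).
rewrite -mulr_suml; clearbody C; move: (\sum_(_ <- _ | _) _) E => S E.
have D0 : 256 * C ^+ 9 != 0 by rewrite mulf_eq0 negb_or pnatr_eq0 expf_neq0.
move: (256 * C ^+ 9) D0 E => D D0 E.
by apply: (mulfI k0); rewrite mulrA E mulVKf // mulrAC divff // mul1r.
Qed.

Lemma check8P s : check8 s -> path_moment8 s = formula8 s.
Proof.
have litE : ratZ \o Zlit = ratlit by apply/funext/ratZ_lit.
have Zs : ratZ (Z.of_nat s) = s%:R.
  by rewrite -(rmorph_nat ratZ); congr (ratZ _); lia.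
apply: path_moment8_of_check (ratZ_lit _) _ _.
  exact: etrans (rmorph_numerator8 ratZ Zlit _)
    (congr2 (fun l => numerator8 l) litE Zs).
by rewrite -ratZ_lit ratZ_eq0.
Qed.

Lemma path_moment8E : path_moment8 =1 formula8.
Proof.
apply: (upoly_eq upoly_path_moment8 upoly_formula8) => s s24.
by apply: check8P; have /allP := check8_le24; apply; rewrite mem_iota.
Qed.

Theorem theorem8 (s : nat) (hs : (0 < s)%N) :
  let x : rat := s%:R in
  let P : rat :=
      308851624%:R * x ^+ 18 - 2759073420%:R * x ^+ 17
    + 7345195650%:R * x ^+ 16 + 1614779679%:R * x ^+ 15
    - 27716691813%:R * x ^+ 14 - 3203324556%:R * x ^+ 13
    + 61922226136%:R * x ^+ 12 + 52270343442%:R * x ^+ 11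
    - 49025878614%:R * x ^+ 10 - 146716496688%:R * x ^+ 9
    - 153171599682%:R * x ^+ 8 - 30342055161%:R * x ^+ 7
    + 158893451131%:R * x ^+ 6 - 165853921776%:R * x ^+ 5
    + 1073038790016%:R * x ^+ 4 + 9260929255680%:R * x ^+ 3
    - 11293714925568%:R * x ^+ 2 - 19188060088320%:R * x
    + 21924617379840%:R in
  central_moment (cores s s.+1) partition_size 8
  = 914624815104000%:R^-1
    * (x ^+ 2 * (x - 1) * (2 * x + 1) * (x + 1) ^+ 2 * P).
Proof.
cbv zeta; rewrite (central_moment_cores hs) path_moment8E.
(* Once [ratlit] is unfolded the numerals agree with those of the statement as unevaluated
   decimals. *)
rewrite /formula8 /numerator8 /ratlit; reflexivity.
Qed.
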